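(* Let $\mathfrak{H}$, $\mathfrak{H}y$, $Z_q^t$, $\varphi_\hbar^t$, $S_\hbar^t$, $\ast$ and $\stackrel{t}{\circledast}_\hbar$ be as defined in the context below. For every integer $m\geq 1$ and all $v,w\in\mathfrak{H}y$, \[ \sum_{\substack{i+j=m\\ i,j\geq 1}} Z_q^t\bigl(\varphi_\hbar^t(v)\stackrel{t}{\circledast}_\hbar(-tx+y-\hbar t)^{i-1}y\bigr)\, Z_q^t\bigl(\varphi_\hbar^t(w)\stackrel{t}{\circledast}_\hbar(-tx+y-\hbar t)^{j-1}y\bigr) = -Z_q^t\Bigl(\varphi_\hbar^t\,(S_\hbar^t)^{-1}\bigl(S_\hbar^t(v)\ast S_\hbar^t(w)\bigr)\stackrel{t}{\circledast}_\hbar(-tx+y-\hbar t)^{m-1}y\Bigr). \]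
   Context: Let $q$, $t$ be formal parameters and $[n]=\frac{1-q^n}{1-q}$. For positive integers $k_1,\dots,k_l$ with $k_1\ge 2$ put $\zeta_q(k_1,\dots,k_l)=\sum_{m_1>m_2>\cdots>m_l\ge1}\prod_{a=1}^l \frac{q^{(k_a-1)m_a}}{[m_a]^{k_a}}\in\mathbb{Q}[[q]]$. The weight of an index $(k_1,\dots,k_l)$ is $k_1+\cdots+k_l$ and its depth is $l$. Define $\zeta_q^t(k_1,\dots,k_l)=\sum'_{\mathbf p}(1-q)^{k-\mathrm{wt}(\mathbf p)}\zeta_q(\mathbf p)\,t^{l-\mathrm{dep}(\mathbf p)}\in\mathbb{Q}[[q]][t]$, where $k=k_1+\cdots+k_l$ and $\mathbf p$ runs over all indices of the form $(k_1\ \square\ k_2\ \square\cdots\square\ k_l)$ in which each $\square$ is filled by one of the three symbols '','' (comma), ''$+$'' or ''$-1+$'' (e.g. $(3\,{-1+}\,2, 1)=(4,1)$). Let $\hbar$ be a formal variable and $\mathfrak{H}=\mathbb{Q}[\hbar,t]\langle x,y\rangle$ the noncommutative polynomial algebra over $\mathbb{Q}[\hbar,t]$; put $\mathfrak{H}^1=\mathbb{Q}[\hbar,t]+\mathfrak{H}y$, $\mathfrak{H}^0=\mathbb{Q}[\hbar,t]+x\mathfrak{H}y$, and $z_j=x^{j-1}y$ ($j\ge1$). Let $\widehat Z_q^t:\mathfrak{H}^0\to\mathbb{Q}[\hbar,t][[q]]$ be the $\mathbb{Q}[\hbar,t]$-linear map with $\widehat Z_q^t(1)=1$ and $\widehat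 Z_q^t(z_{k_1}\cdots z_{k_l})=\zeta_q^t(k_1,\dots,k_l)$ ($k_1\ge2$), and let $Z_q^t=f\circ\widehat Z_q^t$ where $f$ substitutes $\hbar\mapsto 1-q$. Let $\mathfrak z$ be the $\mathbb{Q}[\hbar,t]$-span of $\{z_j\}_{j\ge1}$, with the bilinear product $z_i\circ_+ z_j=z_{i+j}+\hbar z_{i+j-1}$, extended to an action of $\mathfrak z$ on $\mathfrak{H}^1$ by $z_i\circ_+1=0$, $z_i\circ_+(z_jw)=(z_i\circ_+z_j)w$. Let $S_\hbar^t:\mathfrak{H}^1\to\mathfrak{H}^1$ be the $\mathbb{Q}[\hbar,t]$-linear map with $S_\hbar^t(1)=1$ and $S_\hbar^t(z_kw)=z_kS_\hbar^t(w)+t\,z_k\circ_+S_\hbar^t(w)$ for words $w\in\mathfrak{H}^1$ (it is bijective). Let $\varphi$ be the algebra automorphism of $\mathfrak{H}$ with $\varphi(x)=x+y$, $\varphi(y)=-y$, and $\varphi_\hbar^t=-(S_\hbar^t)^{-1}\varphi S_\hbar^t$. The harmonic product $\ast$ on $\mathfrak{H}^1$ is the $\mathbb{Q}[\hbar,t]$-bilinear product with $1\ast w=w\ast 1=w$ and $z_iu\ast z_jv=z_i(u\ast z_jv)+z_j(z_iu\ast v)+z_{i+j}(u\ast v)$ for words $u,v,w$. The product $\ast_+$ on $\mathfrak{H}^1$ is defined by the same rules with the last term replaced by $(z_i\circ_+z_j)(u\ast_+v)$. On $\mathfrak{H}y$ define $z_iu\circledast_\hbar z_jv=z_{i+j}(u\ast_+v)$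 ($i,j\ge1$, $u,v\in\mathfrak{H}^1$, extended bilinearly) and $u\stackrel{t}{\circledast}_\hbar v=(S_\hbar^t)^{-1}\bigl(S_\hbar^t(u)\circledast_\hbar S_\hbar^t(v)\bigr)$. *)

(* Defs.v *)
From HB Require Import structures.
From mathcomp Require Import all_boot all_order all_algebra.
From mathcomp Require Import finmap.
From mathcomp.multinomials Require Import monalg.

Set Implicit Arguments.
Unset Strict Implicit.
Unset Printing Implicit Defensive.

Import Order.TTheory GRing.Theory Num.Theory.
Local Open Scope ring_scope.

Definition A := {poly {poly rat}}.
Definition hbarA : A := 'X.
Definition tA : A := ('X : {poly rat})%:P.

(* Words in the letters x (= true) and y (= false). *)
Definition Word := fmonom bool.

Definition H := {malg A[Word]}.

Definition wordH (s : seq bool) : H := << FMonom s >>.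
Definition xH : H := wordH [:: true].
Definition yH : H := wordH [:: false].
Definition zH (j : nat) : H := xH ^+ j.-1 * yH.

Definition linext (h : Word -> H) (g : H) : H :=
  mmap (fun c : A => c%:MP) h g.

(* Membership predicates:  H^1 = Q[hbar,t] + H y ,   H y . *)
Definition inH1 (u : H) : Prop :=
  forall k : Word, k \in msupp u -> last false (fmonom_val k) = false.
Definition inHy (u : H) : Prop :=
  forall k : Word, k \in msupp u -> last true (fmonom_val k) = false.

(* Decomposition of a word as z_{k_1} ... z_{k_l} x^r : returns (k, r). *)
Fixpoint decomp (w : seq bool) : seq nat * nat :=
  match w with
  | [::] => ([::], 0%N)
  | b :: w' =>
      let (ks, r) := decomp w' in
      if b then
        match ks with
        | [::] => ([::], r.+1)
        | k :: ks' => (k.+1 :: ks', r)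
        end
      else (1%N :: ks, r)
  end.

Definition wordz (ks : seq nat) : H := \prod_(k <- ks) zH k.

Definition circ_zz (i j : nat) : H := zH (i + j) + hbarA *: zH (i + j).-1.

Definition circ_word (i : nat) (w : Word) : H :=
  match decomp (fmonom_val w) with
  | (j :: ks, 0%N) => circ_zz i j * wordz ks
  | _ => 0   (* z_i o_+ 1 = 0; other words are outside H^1 (junk) *)
  end.

Definition circ (i : nat) (u : H) : H := linext (circ_word i) u.

Fixpoint S_idx (ks : seq nat) : H :=
  match ks with
  | [::] => 1
  | k :: ks' => zH k * S_idx ks' + tA *: circ k (S_idx ks')
  end.

Definition S_word (w : Word) : H :=
  let (ks, r) := decomp (fmonom_val w) in S_idx ks * xH ^+ r.
  (* r = 0 on H^1; the trailing x^r only occurs outside H^1 *)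

Definition S_ht (u : H) : H := linext S_word u.

Definition phi_word (w : Word) : H :=
  \prod_(b <- fmonom_val w) (if b then xH + yH else - yH).
Definition phi (u : H) : H := linext phi_word u.

Definition phi_ht (Sinv : H -> H) (u : H) : H := - Sinv (phi (S_ht u)).

Fixpoint harm (u : seq nat) : seq nat -> H :=
  match u with
  | [::] => fun v => wordz v
  | i :: u' =>
      fix harm_in (v : seq nat) : H :=
        match v with
        | [::] => wordz (i :: u')
        | j :: v' => zH i * harm u' v + zH j * harm_in v' + zH (i + j) * harm u' v'
        end
  end.

Fixpoint harmp (u : seq nat) : seq nat -> H :=
  match u with
  | [::] => fun v => wordz v
  | i :: u' =>
      fix harmp_in (v : seq nat) : H :=
        match v with
        | [::] => wordz (i :: u')
        | j :: v' => zH i * harmp u' v + zH j * harmp_in v' + circ_zz i j * harmp u' v'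
        end
  end.

Definition bilin (F : Word -> Word -> H) (u v : H) : H :=
  linext (fun w1 => linext (fun w2 => F w1 w2) v) u.

Definition harm_word (w1 w2 : Word) : H :=
  match decomp (fmonom_val w1), decomp (fmonom_val w2) with
  | (ks1, 0%N), (ks2, 0%N) => harm ks1 ks2
  | _, _ => 0  (* outside H^1 *)
  end.
Definition harmonic (u v : H) : H := bilin harm_word u v.

Definition oast_word (w1 w2 : Word) : H :=
  match decomp (fmonom_val w1), decomp (fmonom_val w2) with
  | (i :: u, 0%N), (j :: v, 0%N) => zH (i + j) * harmp u v
  | _, _ => 0  (* outside H y *)
  end.
Definition oast (u v : H) : H := bilin oast_word u v.

Definition oast_t (Sinv : H -> H) (u v : H) : H := Sinv (oast (S_ht u) (S_ht v)).

(* Formal power series in q with coefficients in Q[t]:  n |-> coeff of q^n. *)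
Definition PS := nat -> {poly rat}.
Definition ps_one : PS := fun n => (n == 0%N)%:R.
Definition ps_q : PS := fun n => (n == 1%N)%:R.
Definition ps_add (f g : PS) : PS := fun n => f n + g n.
Definition ps_opp (f : PS) : PS := fun n => - f n.
Definition ps_mul (f g : PS) : PS := fun n => \sum_(i < n.+1) f i * g (n - i)%N.
Definition ps_pow (f : PS) (k : nat) : PS := iter k (ps_mul f) ps_one.
Definition ps_scale (c : {poly rat}) (f : PS) : PS := fun n => c * f n.
Definition ps_omq : PS := ps_add ps_one (ps_opp ps_q).
(* 1/(1 - q^m) = sum_j q^{m j}  (m >= 1) *)
Definition ps_geom (m : nat) : PS := fun n => (m %| n)%:R.
(* 1/[m] = (1 - q)/(1 - q^m) *)
Definition ps_invbr (m : nat) : PS := ps_mul ps_omq (ps_geom m).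

Definition zterm (k m : nat) : PS :=
  ps_mul (ps_pow ps_q (k.-1 * m)) (ps_pow (ps_invbr m) k).

Fixpoint zsum (ks : seq nat) (B : nat) : PS :=
  match ks with
  | [::] => ps_one
  | k :: ks' => fun n => \sum_(1 <= m < B) ps_mul (zterm k m) (zsum ks' m) n
  end.

(* zeta_q(k): the coefficient of q^n only involves m_1 <= n when k_1 >= 2
   (each term with m_1 = m has q-adic order >= (k_1 - 1) m >= m). *)
Definition zeta_q (ks : seq nat) : PS := fun n => zsum ks n.+1 n.

(* All fillings (k_1 [] k_2 [] ... [] k_l), [] in { "," , "+" , "-1+" },
   listed with multiplicity (one entry per filling). *)
Fixpoint fillings (ks : seq nat) : seq (seq nat) :=
  match ks with
  | [::] => [:: [::]]
  | [:: k] => [:: [:: k]]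
  | k :: ks' =>
      flatten [seq [:: k :: p; (k + head 0%N p)%N :: behead p;
                       (k + head 0%N p).-1 :: behead p] | p <- fillings ks']
  end.

Definition zeta_qt (ks : seq nat) : PS :=
  fun n => \sum_(p <- fillings ks)
    ps_scale ('X ^+ (size ks - size p))
      (ps_mul (ps_pow ps_omq (sumn ks - sumn p)) (zeta_q p)) n.

(* Value of hat Z_q^t on a word (of H^0); other words are not in the
   domain H^0 and get the junk value 0. *)
Definition zetaW (w : Word) : PS :=
  match decomp (fmonom_val w) with
  | ([::], 0%N) => ps_one
  | (k :: ks, 0%N) => if (2 <= k)%N then zeta_qt (k :: ks) else (fun _ => 0)
  | _ => fun _ => 0
  end.

Definition fsub (a : A) : PS :=
  fun n => \sum_(i < size a) (a`_i * ps_pow ps_omq i n).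

Definition Zqt (g : H) : PS :=
  fun n => \sum_(k <- msupp g) ps_mul (fsub (g@_k)) (zetaW k) n.

Definition Pel : H := - (tA *: xH) + yH - (hbarA * tA)%:MP.

(* Main.v *)
(* Conjugating by S reduces everything to t = 0.  On H y the map S is P y |-> sigma(P) y
   for an automorphism sigma, it sends (-tx+y-ht)^(i-1) y to y^i, and Z^t = Z o S, so with
   V = S(v), W = S(w) the claim is that
     F_V(X) = sum_(m >= 1) Z(oast(phi(V), y^m)) X^m   satisfies   F_V F_W = F_(V * W).
   Let zv_N(V) be the part of the sum defining Z(V) with m_1 = N.  Then
     F_V(X) = sum_N q^N zv_N(phi V) G_N(X),  G_N(X) = X/[N] prod_(0 < j < N) (1 + X/[j]),
   and at X = -[n] this is a finite q-binomial transform, which turns out to be the strict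
   sum over n >= m_1 > m_2 > ... of the products of (q^m_a/[m_a])^k_a.  These sums
   multiply like the harmonic product, so the two sides agree at X = -[n] for all n.
   To conclude, truncate at N < B: the difference P of the two sides is a polynomial with
   q^j | P_j that vanishes at -[0], ..., -[B-1], and dividing P by the monic polynomial
   prod_(n < B) (X + [n]) shows that q^B divides P. *)

Require Import Defs.
From HB Require Import structures.
From mathcomp Require Import all_boot all_order all_algebra.
From mathcomp Require Import finmap.
From mathcomp.multinomials Require Import monalg.
From mathcomp Require Import boolp ring zify.

Set Implicit Arguments.
Unset Strict Implicit.
Unset Printing Implicit Defensive.

Import GRing.Theory.
Local Open Scope ring_scope.

(** * Free algebras on two letters *)

(* The free algebra on two letters through the universal property of its linear maps;
   an abstract carrier keeps unification from unfolding products in {malg A[Word]}. *)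
Record wordAlg (K : comNzRingType) := WordAlg {
  wa_sort :> nzRingType;
  cst : {rmorphism K -> wa_sort};
  word : seq bool -> wa_sort;
  wext : forall S : nzRingType, {rmorphism K -> S} -> (seq bool -> S) -> wa_sort -> S;
  cstC : forall c u, u * cst c = cst c * u;
  word0 : word [::] = 1;
  word_cat : forall s s', word (s ++ s') = word s * word s';
  word_ind : forall P : wa_sort -> Prop, P 0 ->
    (forall u v, P u -> P v -> P (u + v)) ->
    (forall c s, P (cst c * word s)) -> forall u, P u;
  wextD : forall S f h u v, @wext S f h (u + v) = @wext S f h u + @wext S f h v;
  wextZ : forall S f h c u, @wext S f h (cst c * u) = f c * @wext S f h u;
  wext_word : forall S f h s, @wext S f h (word s) = h s }.

Section WordAlgebra.
Variables (K : comNzRingType) (W : wordAlg K).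

Definition wx : W := word W [:: true].
Definition wy : W := word W [:: false].

Lemma word_cons b s : word W (b :: s) = word W [:: b] * word W s.
Proof. by rewrite -word_cat. Qed.

Lemma word_rcons s : word W (rcons s false) = word W s * wy.
Proof. by rewrite -cats1 word_cat. Qed.

Section Linear.
Variables (S : nzRingType) (f : {rmorphism K -> S}).

(** Linearity is relative to a ring morphism [f], so that one notion covers endomorphisms of the
    algebra and evaluations in another ring such as power series. *)
Definition wlinear (L : W -> S) :=
  (forall u v, L (u + v) = L u + L v) /\ (forall c u, L (cst W c * u) = f c * L u).

Lemma wext_linear h : wlinear (wext f h).
Proof. by split; [apply: wextD | apply: wextZ]. Qed.

Section Theory.
Variables (L : W -> S) (linL : wlinear L).

Lemma wlinearD u v : L (u + v) = L u + L v.
Proof. exact: linL.1. Qed.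

Lemma wlinearZ c u : L (cst W c * u) = f c * L u.
Proof. exact: linL.2. Qed.

Lemma wlinear0 : L 0 = 0.
Proof. by have := wlinearZ 0 0; rewrite !rmorph0 !mul0r. Qed.

Lemma wlinearN u : L (- u) = - L u.
Proof. by rewrite -mulN1r -(rmorph1 (cst W)) -rmorphN wlinearZ rmorphN1 mulN1r. Qed.

Lemma wlinear_sum (I : Type) (r : seq I) (P : pred I) (F : I -> W) :
  L (\sum_(i <- r | P i) F i) = \sum_(i <- r | P i) L (F i).
Proof. by elim/big_rec2: _ => [|i u v _ <-]; rewrite ?wlinear0 ?wlinearD. Qed.

End Theory.

Lemma wlinear_comp (L : W -> S) (g : W -> W) :
  wlinear L -> (forall u v, g (u + v) = g u + g v) ->
  (forall c u, g (cst W c * u) = cst W c * g u) -> wlinear (fun u => L (g u)).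
Proof. by move=> [LD LZ] gD gZ; split=> *; rewrite ?gD ?gZ. Qed.

Lemma wlinear_mull (L : W -> S) p : wlinear L -> wlinear (fun u => L (p * u)).
Proof.
move=> linL; apply: wlinear_comp => // *; first exact: mulrDr.
by rewrite mulrA cstC mulrA.
Qed.

Lemma wlinear_mulr (L : W -> S) p : wlinear L -> wlinear (fun u => L (u * p)).
Proof. by move=> linL; apply: wlinear_comp => // *; rewrite ?mulrDl ?mulrA. Qed.

Lemma eq_wlinear L1 L2 : wlinear L1 -> wlinear L2 ->
  (forall s, L1 (word W s) = L2 (word W s)) -> L1 =1 L2.
Proof.
move=> lin1 lin2 E; elim/word_ind => [|u v IHu IHv|c s].
- by rewrite (wlinear0 lin1) (wlinear0 lin2).
- by rewrite (wlinearD lin1) (wlinearD lin2) IHu IHv.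
- by rewrite (wlinearZ lin1) (wlinearZ lin2) E.
Qed.

Lemma wlinear_scale (L : W -> S) a : (forall c b, b * f c = f c * b) ->
  wlinear L -> wlinear (fun u => a * L u).
Proof. by move=> mulr_morphC [LD LZ]; split=> *; rewrite ?LD ?LZ ?mulrDr // !mulrA mulr_morphC. Qed.

Lemma wlinear_ext (L1 L2 : W -> S) : wlinear L1 -> L1 =1 L2 -> wlinear L2.
Proof. by move=> [D Z] E; split=> *; rewrite -!E ?D ?Z. Qed.

Lemma wlinear_add (L1 L2 : W -> S) :
  wlinear L1 -> wlinear L2 -> wlinear (fun u => L1 u + L2 u).
Proof.
by move=> [D1 Z1] [D2 Z2]; split=> *; rewrite ?D1 ?D2 ?Z1 ?Z2 ?mulrDr // addrACA.
Qed.

End Linear.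

Local Notation endo := (wlinear (cst W)).

Lemma endo_id : endo id.
Proof. by []. Qed.

Lemma wlinear_endo (S : nzRingType) (f : {rmorphism K -> S}) (L : W -> S) (g : W -> W) :
  wlinear f L -> endo g -> wlinear f (fun u => L (g u)).
Proof. by move=> linL [gD gZ]; apply: wlinear_comp. Qed.

Definition bilext (F : seq bool -> seq bool -> W) (u v : W) : W :=
  wext (cst W) (fun s => wext (cst W) (F s) v) u.

Lemma bilext_linearl F v : endo (bilext F ^~ v).
Proof. exact: wext_linear. Qed.

(** Both sides are linear in [u], so [u] may be taken to be a word, and then [bilext F u] is a
    single [wext]. *)
Lemma bilext_linearr F u : endo (bilext F u).
Proof.
split=> [v w|c v]; move: u; apply: eq_wlinear.
- exact: bilext_linearl.
- by apply: wlinear_add; apply: bilext_linearl.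
- by move=> s; rewrite /bilext !wext_word wextD.
- exact: bilext_linearl.
- by apply: wlinear_scale => [d b|]; [rewrite cstC | apply: bilext_linearl].
- by move=> s; rewrite /bilext !wext_word wextZ.
Qed.

Lemma bilext_word F s s' : bilext F (word W s) (word W s') = F s s'.
Proof. by rewrite /bilext !wext_word. Qed.

Definition subst (g : bool -> W) : W -> W :=
  wext (cst W) (fun s => \prod_(b <- s) g b).

Lemma subst_linear g : endo (subst g).
Proof. exact: wext_linear. Qed.

Lemma subst_word g s : subst g (word W s) = \prod_(b <- s) g b.
Proof. exact: wext_word. Qed.

Lemma subst_letter g b : subst g (word W [:: b]) = g b.
Proof. by rewrite subst_word big_seq1. Qed.

Lemma substM g u v : subst g (u * v) = subst g u * subst g v.
Proof.
have lin := subst_linear g.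
move: u; apply: eq_wlinear; first exact: (wlinear_mulr _ lin).
  exact: (wlinear_endo (wlinear_mulr _ endo_id) lin).
move=> s; move: v; apply: eq_wlinear; first exact: (wlinear_mull _ lin).
  exact: (wlinear_endo (wlinear_mull _ endo_id) lin).
by move=> s'; rewrite -word_cat !subst_word big_cat.
Qed.

Lemma subst1 g : subst g 1 = 1.
Proof. by rewrite -(word0 W) subst_word big_nil word0. Qed.

Lemma substX g u n : subst g (u ^+ n) = subst g u ^+ n.
Proof.
elim: n => [|n IH]; first by rewrite !expr0 subst1.
by rewrite !exprS substM IH.
Qed.

Lemma subst_cst g c : subst g (cst W c) = cst W c.
Proof. by rewrite -[cst W c]mulr1 (wlinearZ (subst_linear g)) subst1. Qed.

Lemma subst_comp g g' :
  (forall b, subst g (g' b) = word W [:: b]) -> cancel (subst g') (subst g).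
Proof.
move=> gg'; apply: eq_wlinear; last 1 first.
- elim=> [|b s IH]; first by rewrite word0 !subst1.
  by rewrite word_cons !substM IH subst_letter gg'.
- by apply: wlinear_endo; apply: subst_linear.
- exact: endo_id.
Qed.

Definition isHy (u : W) := exists P, u = P * wy.

Lemma isHyM u v : isHy v -> isHy (u * v).
Proof. by move=> [P ->]; exists (u * P); rewrite mulrA. Qed.

Lemma isHy0 : isHy 0.
Proof. by exists 0; rewrite mul0r. Qed.

Lemma isHyD u v : isHy u -> isHy v -> isHy (u + v).
Proof. by move=> [P ->] [Q ->]; exists (P + Q); rewrite mulrDl. Qed.

Lemma isHyN u : isHy u -> isHy (- u).
Proof. by move=> Hu; rewrite -mulN1r; apply: isHyM. Qed.

Lemma isHy_word s : isHy (word W (rcons s false)).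
Proof. by exists (word W s); rewrite word_rcons. Qed.

Lemma isHy_ind (P : W -> Prop) : P 0 ->
  (forall u v, P u -> P v -> P (u + v)) ->
  (forall c s, P (cst W c * word W (rcons s false))) -> forall u, isHy u -> P u.
Proof.
move=> P0 PD Pw _ [Q ->]; elim/word_ind: Q => [|u v IHu IHv|c s].
- by rewrite mul0r.
- by rewrite mulrDl; apply: PD.
- by rewrite -mulrA -word_rcons.
Qed.

Lemma eq_wlinear_Hy (S : nzRingType) (f : {rmorphism K -> S}) L1 L2 :
  wlinear f L1 -> wlinear f L2 ->
  (forall s, L1 (word W (rcons s false)) = L2 (word W (rcons s false))) ->
  forall u, isHy u -> L1 u = L2 u.
Proof.
move=> lin1 lin2 E _ [P ->]; move: P.
apply: eq_wlinear (wlinear_mulr _ lin1) (wlinear_mulr _ lin2) _.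
by move=> s; rewrite -word_rcons.
Qed.

Lemma bilext_isHy F u v :
  (forall s s', isHy (F (rcons s false) (rcons s' false))) ->
  isHy u -> isHy v -> isHy (bilext F u v).
Proof.
move=> HF; elim/isHy_ind: u / => [|u1 u2 IH1 IH2|c s] Hv.
- by rewrite (wlinear0 (bilext_linearl F v)); apply: isHy0.
- by rewrite (wlinearD (bilext_linearl F v)); apply: isHyD; auto.
rewrite (wlinearZ (bilext_linearl F v)); apply: isHyM.
have lin := bilext_linearr F (word W (rcons s false)).
elim/isHy_ind: v / Hv => [|v1 v2 IH1 IH2|d s'].
- by rewrite (wlinear0 lin); apply: isHy0.
- by rewrite (wlinearD lin); apply: isHyD.
- by rewrite (wlinearZ lin) bilext_word; apply: isHyM.
Qed.

(** * Words in the letters z_k *)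

Definition wz (j : nat) : W := wx ^+ j.-1 * wy.

Definition wwz (ks : seq nat) : W := \prod_(k <- ks) wz k.

Lemma wz1 : wz 1 = wy.
Proof. by rewrite /wz expr0 mul1r. Qed.

Lemma wzS k : (0 < k)%N -> wz k.+1 = wx * wz k.
Proof. by case: k => // k _; rewrite /wz /= exprS mulrA. Qed.

Lemma isHy_wz k : isHy (wz k).
Proof. by exists (wx ^+ k.-1). Qed.

Lemma wwz_nil : wwz [::] = 1.
Proof. exact: big_nil. Qed.

Lemma wwz_cons k ks : wwz (k :: ks) = wz k * wwz ks.
Proof. exact: big_cons. Qed.

Lemma isHy_wwz k ks : isHy (wwz (k :: ks)).
Proof.
elim: ks k => [|k' ks IH] k; rewrite wwz_cons; last exact/isHyM/IH.
by rewrite wwz_nil mulr1; apply: isHy_wz.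
Qed.

Lemma decomp_gt0 s : all (leq 1) (decomp s).1.
Proof.
by elim: s => //= b s; case: (decomp s) => -[|k ks] r /=; case: b => //= /andP[].
Qed.

(** A final y leaves no trailing power of x. Case analysis with this view discards the junk branches
    of every function defined through [decomp]. *)
Variant decomp_rcons_spec s : seq nat * nat -> Prop :=
  DecompRcons k ks of (0 < k)%N & all (leq 1) ks
    & word W (rcons s false) = wwz (k :: ks)
  : decomp_rcons_spec s (k :: ks, 0%N).

Lemma decomp_rconsP s : decomp_rcons_spec s (decomp (rcons s false)).
Proof.
elim: s => [|b s IH].
  by constructor => //; rewrite wwz_cons wwz_nil mulr1 wz1.
rewrite rcons_cons /=; case: IH => k ks k_gt0 ks_gt0 E.
case: b; constructor => //.
- by rewrite word_cons E !wwz_cons wzS // mulrA.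
- by rewrite /= k_gt0.
- by rewrite word_cons E !wwz_cons wz1.
Qed.

End WordAlgebra.

(** * The map S on H y *)

Section InterpolationMap.
Variables (K : comNzRingType) (W : wordAlg K) (t h : K).
Local Notation x := (wx W).
Local Notation y := (wy W).
Local Notation "c %:W" := (cst W c) (at level 2, format "c %:W").

Definition wcirc_zz (i j : nat) : W := wz W (i + j) + h%:W * wz W (i + j).-1.

Variables (circ : nat -> W -> W) (Sidx : seq nat -> W) (S : W -> W).
Hypothesis circ_linear : forall i, wlinear (cst W) (circ i).
Hypothesis circ_word : forall i s, circ i (word W s) =
  if decomp s is (j :: ks, 0%N) then wcirc_zz i j * wwz W ks else 0.
Hypothesis Sidx_nil : Sidx [::] = 1.
Hypothesis Sidx_cons : forall k ks,
  Sidx (k :: ks) = wz W k * Sidx ks + t%:W * circ k (Sidx ks).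
Hypothesis S_linear : wlinear (cst W) S.
Hypothesis S_word : forall s,
  S (word W s) = Sidx (decomp s).1 * x ^+ (decomp s).2.

Lemma wcirc_zzS i j : (0 < i)%N -> (0 < j)%N -> wcirc_zz i.+1 j = x * wcirc_zz i j.
Proof.
case: i j => [//|i] [//|j] _ _.
rewrite /wcirc_zz mulrDr [x * (_ * _)]mulrA cstC -mulrA.
by rewrite !addSn !addnS /= -!wzS.
Qed.

Lemma circ1 i : circ i 1 = 0.
Proof. by rewrite -(word0 W) circ_word. Qed.

Lemma circS i u : (0 < i)%N -> circ i.+1 u = x * circ i u.
Proof.
move=> i_gt0; move: u; apply: (eq_wlinear (circ_linear _)).
  exact: (wlinear_endo (wlinear_mull _ (endo_id W)) (circ_linear i)).
move=> s; rewrite !circ_word.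
have := decomp_gt0 s; case: (decomp s) => -[|k ks] [|r] //=; rewrite ?mulr0 //.
by case/andP=> k_gt0 _; rewrite wcirc_zzS // mulrA.
Qed.

(** On a first factor z_j the action of z_1 gives z_(j+1) + h z_j = (x + h) z_j. *)
Lemma circ1_Hy u : isHy u -> circ 1 u = (x + h%:W) * u.
Proof.
apply: eq_wlinear_Hy; first exact: circ_linear.
  exact: (wlinear_mull _ (endo_id W)).
move=> s; rewrite circ_word; case: (decomp_rconsP W s) => k ks k_gt0 _ ->.
by rewrite wwz_cons /wcirc_zz add1n /= wzS // -mulrDl mulrA.
Qed.

Lemma circ_Hy i u : (0 < i)%N -> isHy u -> circ i u = x ^+ i.-1 * (x + h%:W) * u.
Proof.
move=> + Hu; case: i => // i _; elim: i => [|i IH].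
  by rewrite circ1_Hy // expr0 mul1r.
by rewrite circS // IH /= exprS !mulrA.
Qed.

(** The image of y is y + t (x + h): the letter stays a separator, or is merged with weight t into
    what follows through the action of z_1. *)
Definition sigma : W -> W :=
  subst (fun b => if b then x else y + t%:W * x + (h * t)%:W).

Definition wPel : W := - (t%:W * x) + y - (h * t)%:W.

Definition sigma_inv : W -> W := subst (fun b => if b then x else wPel).

Lemma sigma_x : sigma x = x.
Proof. exact: subst_letter. Qed.

Lemma sigma_y : sigma y = y + t%:W * x + (h * t)%:W.
Proof. exact: subst_letter. Qed.

Lemma sigmaPel : sigma wPel = y.
Proof.
have lin : wlinear (cst W) sigma := subst_linear _.
rewrite /wPel !(wlinearD lin) !(wlinearN lin) (wlinearZ lin) sigma_x sigma_y.
by rewrite [sigma _]subst_cst -!addrA addrCA addKr subrr addr0.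
Qed.

Lemma sigmaK : cancel sigma_inv sigma.
Proof. by apply: subst_comp => -[]; [apply: sigma_x | apply: sigmaPel]. Qed.

(** The last y is unchanged because [circ] kills 1. Every earlier y is followed by an element of H
    y, on which [circ 1] is left multiplication by x + h. *)
Lemma Sidx_Hy s : Sidx (decomp (rcons s false)).1 = sigma (word W s) * y.
Proof.
elim: s => [|b s].
  by rewrite /= Sidx_cons Sidx_nil circ1 mulr0 addr0 wz1 word0 [sigma 1]subst1 mulr1 mul1r.
rewrite rcons_cons /=; case: (decomp_rconsP W s) => k ks k_gt0 _ _ /= IH.
rewrite word_cons [sigma (_ * _)]substM -/sigma; case: b => /=.
  rewrite Sidx_cons [sigma _]sigma_x -mulrA -IH Sidx_cons mulrDr wzS // mulrA.
  by rewrite circS // !mulrA cstC.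
rewrite Sidx_cons IH circ1_Hy; last by exists (sigma (word W s)).
rewrite [sigma (word W [:: false])]sigma_y wz1 -mulrA !mulrDl mulrDr addrA.
by rewrite [h * t]mulrC rmorphM !mulrA.
Qed.

(* On H y the map S is conjugate to an automorphism of H, because z_k acts on H y
   as left multiplication by x^(k-1) (x + hbar). *)
Lemma S_Hy P : S (P * y) = sigma P * y.
Proof.
move: P; apply: (eq_wlinear (wlinear_mulr _ S_linear)).
  exact: (wlinear_endo (wlinear_mulr _ (endo_id W)) (subst_linear _)).
move=> s; rewrite -word_rcons S_word Sidx_Hy.
by case: (decomp_rconsP W s) => k ks _ _ _; rewrite expr0 mulr1.
Qed.

Lemma S_isHy u : isHy u -> isHy (S u).
Proof. by case=> P ->; rewrite S_Hy; exists (sigma P). Qed.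

Lemma S_sigma_inv P : S (sigma_inv P * y) = P * y.
Proof. by rewrite S_Hy sigmaK. Qed.

Lemma S_wPel i : S (wPel ^+ i * y) = y ^+ i.+1.
Proof. by rewrite S_Hy [sigma _]substX -/sigma sigmaPel exprSr. Qed.

Lemma Sidx_cons_Hy k k' ks : (0 < k)%N -> all (leq 1) (k' :: ks) ->
  isHy (Sidx (k' :: ks)) /\
  Sidx (k :: k' :: ks) = wz W k * Sidx (k' :: ks) +
    t%:W * (x ^+ k.-1 * (x + h%:W) * Sidx (k' :: ks)).
Proof.
move=> k_gt0 ks_gt0; have S_Hy : isHy (Sidx (k' :: ks)).
  elim: ks k' ks_gt0 => [|k2 ks IH] k' /andP[k'_gt0 ks_gt0].
    by rewrite Sidx_cons Sidx_nil circ1 mulr0 addr0 mulr1; apply: isHy_wz.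
  rewrite Sidx_cons circ_Hy //; last exact: IH.
  by apply: isHyD; do ?apply: isHyM; apply: IH.
by split=> //; rewrite Sidx_cons circ_Hy.
Qed.

End InterpolationMap.

(** * Newton interpolation at the points -[n] *)

Section QNewton.
Variables (R : comNzRingType) (q : R) (iv : nat -> R).

Definition qint (n : nat) : R := \sum_(i < n) q ^+ i.

Hypothesis q_reg : forall a b, q * a = q * b -> a = b.
Hypothesis ivK : forall n, iv n.+1 * qint n.+1 = 1.

Lemma qintSr n : qint n.+1 = qint n + q ^+ n.
Proof. by rewrite /qint big_ord_recr. Qed.

Lemma qint0 : qint 0 = 0.
Proof. by rewrite /qint big_ord0. Qed.

Lemma qintD n k : qint (n + k) = qint n + q ^+ n * qint k.
Proof.
elim: k => [|k IH]; first by rewrite addn0 qint0 mulr0 addr0.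
by rewrite addnS !qintSr IH mulrDr exprD addrA.
Qed.

Lemma qintS n : qint n.+1 = 1 + q * qint n.
Proof. by rewrite -add1n qintD qintSr qint0 expr0 add0r. Qed.

Lemma qint_reg n a b : qint n.+1 * a = qint n.+1 * b -> a = b.
Proof. by move/(congr1 ( *%R (iv n.+1))); rewrite !mulrA ivK !mul1r. Qed.

Lemma qexp_reg n a b : q ^+ n * a = q ^+ n * b -> a = b.
Proof.
by elim: n => [|n IH]; rewrite ?expr0 ?mul1r // exprS -!mulrA => /q_reg.
Qed.

Definition qdvd (n : nat) (a : R) := exists r, a = q ^+ n * r.

Lemma qdvd0 n : qdvd n 0.
Proof. by exists 0; rewrite mulr0. Qed.

Lemma qdvdD n a b : qdvd n a -> qdvd n b -> qdvd n (a + b).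
Proof. by move=> [r ->] [s ->]; exists (r + s); rewrite mulrDr. Qed.

Lemma qdvdN n a : qdvd n a -> qdvd n (- a).
Proof. by move=> [r ->]; exists (- r); rewrite mulrN. Qed.

Lemma qdvdMl n a b : qdvd n b -> qdvd n (a * b).
Proof. by move=> [r ->]; exists (a * r); rewrite mulrCA. Qed.

Lemma qdvdM n k a b : qdvd n a -> qdvd k b -> qdvd (n + k) (a * b).
Proof. by move=> [r ->] [s ->]; exists (r * s); rewrite exprD mulrACA. Qed.

Lemma qdvd_leq n k a : (k <= n)%N -> qdvd n a -> qdvd k a.
Proof.
move=> /subnKC <- [r ->].
by exists (q ^+ (n - k) * r); rewrite exprD mulrA.
Qed.

Lemma qdvd_sum n (I : Type) (s : seq I) (P : pred I) (F : I -> R) :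
  (forall i, P i -> qdvd n (F i)) -> qdvd n (\sum_(i <- s | P i) F i).
Proof. by move=> F_dvd; elim/big_ind: _ => //; [apply: qdvd0 | apply: qdvdD]. Qed.

(** A filtration in which X weighs as much as q; dividing by a linear factor raises [k] by one. *)
Definition qfilt (k : nat) (P : {poly R}) := forall j, qdvd (j + k) P`_j.

(** Comparing coefficients gives Q_j = P_(j+1) + a Q_(j+1), so divisibility descends from the top
    coefficient of Q, by induction on [size Q - j]. *)
Lemma qfilt_divX k (P : {poly R}) a :
  qfilt k P -> root P a -> exists2 Q, P = Q * ('X - a%:P) & qfilt k.+1 Q.
Proof.
move=> filtP /factor_theorem [Q defP]; exists Q => //.
have coefQ j : Q`_j = P`_j.+1 + a * Q`_j.+1.
  by rewrite defP mulrBr coefB coefMX coefMC /= [_ * a]mulrC subrK.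
move=> j; have [n] := ubnP (size Q - j)%N; elim: n j => // n IH j lt_n.
have [le_Q | lt_j] := leqP (size Q) j; first by rewrite nth_default //; apply: qdvd0.
rewrite coefQ addnS -addSn; apply: qdvdD; first exact: filtP.
apply/qdvdMl/(@qdvd_leq (j.+1 + k.+1)); first by rewrite addnS leqnSn.
by apply: IH; move: lt_n; rewrite ltnS; apply: leq_trans; rewrite subnS prednK ?subn_gt0.
Qed.

(* Dividing by the monic factors X + [n] moves the weight of the filtration from
   the degree in X to the power of q. *)
Lemma qdvd_coef_roots B k (P : {poly R}) : qfilt k P ->
  (forall n, (n < B)%N -> P.[- qint n] = 0) -> forall j, qdvd (B + k) P`_j.
Proof.
elim: B k P => [|B IH] k P filtP P_root j.
  by apply: qdvd_leq (filtP j); rewrite leq_addl.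
have [|Q defP filtQ] := qfilt_divX filtP (a := - qint B).
  by apply/rootP/P_root.
have Qdvd : forall j, qdvd (B + k.+1) Q`_j.
  apply: IH => // n ltnB.
  have := P_root n (ltnW ltnB); rewrite defP hornerM hornerXsubC opprK.
  (* The value of the removed factor at -[n] is q^n [B - n] with B - n > 0. It can be cancelled, so
     Q vanishes at -[n] as well. *)
  have -> : - qint n + qint B = q ^+ n * qint (B - n.+1).+1.
    by rewrite -[in LHS](subnKC ltnB) addSnnS qintD addKr.
  rewrite mulrC -mulrA -[RHS](mulr0 (q ^+ n)) => /qexp_reg.
  by rewrite -[RHS](mulr0 (qint (B - n.+1).+1)) => /qint_reg.
rewrite addSnnS defP mulrBr coefB coefMX coefMC.
apply: qdvdD; first by case: ifP => _ //; apply: qdvd0.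
by rewrite mulrC; apply/qdvdN/qdvdMl.
Qed.

(** This is the sum of 1/([N_1]...[N_m]) over N = N_1 > ... > N_m > 0, the coefficient of X^m in
    G_N(X). *)
Fixpoint ecoef (m N : nat) : R :=
  if m is m'.+1 then iv N * \sum_(M < N) ecoef m' M else (N == 0)%:R.

Lemma ecoef_gt m N : (N < m)%N -> ecoef m N = 0.
Proof.
elim: m N => // m IH N lt_N /=; rewrite big1 ?mulr0 // => M _.
by apply: IH; apply: leq_trans (ltn_ord M) _.
Qed.

(** This is G_N(X), the product over j < N of (X + [j])/[j+1]. Giving it by coefficients ties it to
    iterated sums; [newtonS] recovers the product. *)
Definition newton (N : nat) : {poly R} := \poly_(m < N.+1) ecoef m N.

Lemma coef_newton N m : (newton N)`_m = ecoef m N.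
Proof. by rewrite coef_poly ltnS; case: leqP => // /ecoef_gt ->. Qed.

Lemma newton0 : newton 0 = 1.
Proof.
apply/polyP => m; rewrite coef_newton coef1.
by case: m => //= m; rewrite big_ord0 mulr0.
Qed.

Lemma newton_sum N :
  qint N *: newton N = 'X * \sum_(M < N) newton M.
Proof.
case: N => [|N]; first by rewrite qint0 scale0r big_ord0 mulr0.
apply/polyP => -[|m]; rewrite coefZ coef_newton coefXM /= ?mulr0 //.
rewrite mulrA [qint _ * _]mulrC ivK mul1r coef_sum.
by apply: eq_bigr => M _; rewrite coef_newton.
Qed.

(** Two consecutive instances of [newton_sum] differ by the single summand X G_N. *)
Lemma newtonS N :
  qint N.+1 *: newton N.+1 = ('X + (qint N)%:P) * newton N.
Proof.
rewrite newton_sum big_ord_recr /= mulrDr -newton_sum mulrDl addrC.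
by rewrite mul_polyC.
Qed.

(** Equals (-1)^N q^(N(N-1)/2) times the q-binomial coefficient of n over N. The lemmas [nvalSS],
    [nval_pascal] and [nval_diff] are its absorption rule and its two Pascal rules. *)
Definition nval (n N : nat) : R := (newton N).[- qint n].

Lemma nvaln0 n : nval n 0 = 1.
Proof. by rewrite /nval newton0 hornerC. Qed.

Lemma nvalS n N : qint N.+1 * nval n N.+1 = (qint N - qint n) * nval n N.
Proof.
rewrite /nval -hornerZ newtonS hornerM hornerD hornerX hornerC.
by rewrite [- _ + _]addrC.
Qed.

Lemma nvalSS n N : qint N.+1 * nval n.+1 N.+1 = - (qint n.+1 * q ^+ N * nval n N).
Proof.
elim: N => [|N IH].
  by rewrite nvalS !nvaln0 expr0 qint0 !mulr1 sub0r.
apply: (@qint_reg N); rewrite nvalS mulrCA IH.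
transitivity (- (qint n.+1 * q ^+ N.+1) * (qint N.+1 * nval n N.+1)); last by ring.
by rewrite nvalS !qintS exprS; ring.
Qed.

Lemma nval_pascal n N :
  nval n.+1 N.+1 = q ^+ N.+1 * nval n N.+1 - q ^+ N * nval n N.
Proof.
apply: (@qint_reg N); rewrite nvalSS mulrBr mulrCA nvalS !qintS exprS; ring.
Qed.

Lemma nval_diff n N : nval n.+1 N.+1 - nval n N.+1 = - (q ^+ n * nval n N).
Proof.
apply: (@qint_reg N); rewrite mulrBr nvalSS nvalS.
have E : qint n.+1 * q ^+ N + qint N - qint n = q ^+ n * qint N.+1.
  have -> : qint n.+1 * q ^+ N + qint N = qint n + q ^+ n * qint N.+1.
    by rewrite mulrC addrC -!qintD addnS addnC addnS.
  by rewrite addrC addKr.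
transitivity (- ((qint n.+1 * q ^+ N + qint N - qint n) * nval n N)); first by ring.
by rewrite E; ring.
Qed.

Lemma nval_gt n N : (n < N)%N -> nval n N = 0.
Proof.
elim: N => // N IH; rewrite ltnS leq_eqVlt => ltn.
apply: (@qint_reg N); rewrite nvalS mulr0.
by case/orP: ltn => [/eqP <-|/IH ->]; rewrite ?subrr ?mul0r ?mulr0.
Qed.

(** The value at X = -[n] of the sum of q^N a_N G_N(X) over N < B. *)
Definition qtrans (B n : nat) (a : nat -> R) : R :=
  \sum_(N < B) q ^+ N * nval n N * a N.

Lemma qtrans0 B a : qtrans B.+1 0 a = a 0%N.
Proof.
rewrite /qtrans big_ord_recl /= nvaln0 expr0 !mul1r big1 ?addr0 // => N _.
by rewrite nval_gt // mulr0 mul0r.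
Qed.

(** Differencing in n lowers both arguments of [nval] by [nval_diff]; absorption raises them again
    and trades the factor 1/[N] for 1/[n+1]. *)
Lemma qtrans_diff B n a : a 0%N = 0 ->
  qtrans B n.+1 (fun N => iv N * a N) - qtrans B n (fun N => iv N * a N)
  = q ^+ n.+1 * iv n.+1 * \sum_(N < B) nval n.+1 N * a N.
Proof.
move=> a0; rewrite /qtrans -sumrB mulr_sumr; apply: eq_bigr => -[[|N] ltN] _ /=.
  by rewrite a0 !mulr0 subrr.
rewrite -mulrBl -mulrBr nval_diff.
apply: (@qint_reg n).
transitivity ((iv n.+1 * qint n.+1) * q ^+ n.+1 * (nval n.+1 N.+1 * a N.+1)); last by ring.
rewrite ivK mul1r; apply: (@qint_reg N).
transitivity ((iv N.+1 * qint N.+1) * - (qint n.+1 * q ^+ N * nval n N) * q ^+ n.+1 * a N.+1).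
  by rewrite !exprS; ring.
by rewrite ivK mul1r -nvalSS; ring.
Qed.

(** If [a] lists the values of an element u, then [b] lists those of y u. After [qtrans_diff] the
    inner partial sums are removed by Abel summation, with the q-Pascal rule as its telescoping
    step. *)
Lemma qtrans_y B n (a : nat -> R) : (n.+1 < B)%N ->
  let b := fun N => iv N * \sum_(M < N) a M in
  qtrans B n.+1 b - qtrans B n b = - (q ^+ n.+1 * iv n.+1 * qtrans B n a).
Proof.
move=> ltn /=; rewrite qtrans_diff ?big_ord0 // -mulrN; congr (_ * _).
case: B ltn => // B; rewrite ltnS => ltn.
have abel k : \sum_(N < k.+1) nval n.+1 N * \sum_(M < N) a M =
    q ^+ k * nval n k * (\sum_(M < k.+1) a M) - qtrans k.+1 n a.
  elim: k => [|k IH].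
    by rewrite /qtrans !big_ord_recl !big_ord0 !addr0 mulr0 subrr.
  have -> : qtrans k.+2 n a = qtrans k.+1 n a + q ^+ k.+1 * nval n k.+1 * a k.+1.
    by rewrite /qtrans big_ord_recr.
  rewrite big_ord_recr /= IH nval_pascal.
  by rewrite [\sum_(M < k.+2) a M]big_ord_recr /=; ring.
(* The boundary term vanishes because n is smaller than the last index of the sum. *)
by rewrite abel nval_gt // mulr0 mul0r sub0r.
Qed.

(** Here [b] lists the values of (x + y) u, where x + y is the image of x under phi. The y part
    subtracts the transform at n, so an increment of the transform of [a] remains. *)
Lemma qtrans_x B n (a : nat -> R) : (n.+1 < B)%N -> a 0%N = 0 ->
  let b := fun N => q ^+ N * iv N * a N + iv N * \sum_(M < N) a M in
  qtrans B n.+1 b - qtrans B n b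
  = q ^+ n.+1 * iv n.+1 * (qtrans B n.+1 a - qtrans B n a).
Proof.
move=> ltn a0 /=.
have split_trans k : qtrans B k (fun N => q ^+ N * iv N * a N + iv N * \sum_(M < N) a M) =
    qtrans B k (fun N => iv N * (q ^+ N * a N)) +
    qtrans B k (fun N => iv N * \sum_(M < N) a M).
  by rewrite /qtrans -big_split; apply: eq_bigr => N _ /=; ring.
rewrite !split_trans opprD addrACA qtrans_y // qtrans_diff ?a0 ?mulr0 //.
rewrite mulrBr; congr (_ * _ - _); apply: eq_bigr => N _; ring.
Qed.

Definition kseries (B : nat) (a : nat -> R) (m : nat) : R :=
  \sum_(N < B) q ^+ N * a N * ecoef m N.

Lemma kseries_mul B (a b c : nat -> R) :
  (forall n, (n < B)%N -> qtrans B n a * qtrans B n b = qtrans B n c) ->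
  forall m, qdvd B (\sum_(i < m.+1) kseries B a i * kseries B b (m - i) - kseries B c m).
Proof.
move=> abc m.
pose F (u : nat -> R) : {poly R} := \sum_(N < B) (q ^+ N * u N) *: newton N.
have coefF u j : (F u)`_j = kseries B u j.
  by rewrite coef_sum; apply: eq_bigr => N _; rewrite coefZ coef_newton.
have hornerF u n : (F u).[- qint n] = qtrans B n u.
  rewrite horner_sum; apply: eq_bigr => N _; rewrite hornerZ -/(nval n N); ring.
have filtF u j : qdvd j (F u)`_j.
  rewrite coefF; apply: qdvd_sum => N _.
  (* Only N >= j contribute to the coefficient of X^j, and these terms carry q^N. *)
  have [ltN | leN] := ltnP N j; first by rewrite ecoef_gt ?mulr0 //; apply: qdvd0.
  rewrite mulrAC mulrC; apply/qdvdMl; rewrite mulrC; apply/qdvdMl/(qdvd_leq leN).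
  by exists 1; rewrite mulr1.
suff : qdvd (B + 0) (F a * F b - F c)`_m.
  by rewrite addn0 coefB coefM coefF; under eq_bigr do rewrite !coefF.
apply: qdvd_coef_roots => [j|n ltn]; last first.
  by rewrite hornerD hornerN hornerM !hornerF abc // subrr.
rewrite coefB addn0; apply: qdvdD; last exact/qdvdN/filtF.
rewrite coefM; apply: qdvd_sum => -[i lti] _ /=.
by rewrite -[j in qdvd j](@subnKC i) //; apply: qdvdM; apply: filtF.
Qed.

End QNewton.

(** * Iterated sums and quasi-shuffle products *)

Section QuasiShuffle.
Variables (K : comNzRingType) (W : wordAlg K) (c : nat -> nat -> W).

(** The recursion copies that of [harm] and [harmp] with a free contraction [c], so that both are
    instances up to conversion. *)
Fixpoint qsh (us : seq nat) : seq nat -> W :=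
  match us with
  | [::] => fun vs => wwz W vs
  | i :: us' =>
      fix qsh_in (vs : seq nat) : W :=
        match vs with
        | [::] => wwz W (i :: us')
        | j :: vs' =>
            wz W i * qsh us' vs + wz W j * qsh_in vs' + c i j * qsh us' vs'
        end
  end.

Lemma qsh_nilr us : qsh us [::] = wwz W us.
Proof. by case: us. Qed.

Lemma qsh_cons i us j vs : qsh (i :: us) (j :: vs) =
  wz W i * qsh us (j :: vs) + wz W j * qsh (i :: us) vs + c i j * qsh us vs.
Proof. by []. Qed.

Lemma qsh_ind (P : seq nat -> seq nat -> Prop) :
  (forall vs, P [::] vs) -> (forall us, P us [::]) ->
  (forall i us j vs, P us (j :: vs) -> P (i :: us) vs -> P us vs ->
    P (i :: us) (j :: vs)) ->
  forall us vs, P us vs.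
Proof.
move=> P0l P0r PS; elim=> [|i us IHu]; first exact: P0l.
by elim=> [|j vs IHv]; [apply: P0r | apply: PS].
Qed.

Lemma isHy_wzM k u : isHy (wy W * u) -> isHy (wz W k * u).
Proof. by rewrite /wz -mulrA; apply: isHyM. Qed.

Hypothesis c_Hy : forall i j u, isHy (wy W * u) -> isHy (c i j * u).

(** The prefix y makes the statement hold also when both indices are empty and the product is 1,
    which is not in H y. *)
Lemma qsh_near_Hy us vs : isHy (wy W * qsh us vs).
Proof.
have wwzH ks : isHy (wy W * wwz W ks).
  case: ks => [|k ks]; last exact/isHyM/isHy_wwz.
  by rewrite wwz_nil mulr1; exists 1; rewrite mul1r.
move: us vs; apply: qsh_ind => [vs|us|i us j vs H1 H2 H3]; rewrite ?qsh_nilr; try exact: wwzH.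
by apply: isHyM; rewrite qsh_cons; do ?apply: isHyD; do ?apply: isHy_wzM; auto.
Qed.

Lemma qsh_Hy i us j vs : isHy (qsh (i :: us) (j :: vs)).
Proof.
rewrite qsh_cons; have H := qsh_near_Hy.
by do ?apply: isHyD; [apply: isHy_wzM | apply: isHy_wzM | apply: c_Hy].
Qed.

End QuasiShuffle.

(** * Words evaluated as nested sums *)

Section IteratedSums.
Variables (K : comNzRingType) (W : wordAlg K) (R : comNzRingType).
Variables (f : {rmorphism K -> R}) (alpha beta : nat -> R).
Local Notation x := (wx W).
Local Notation y := (wy W).

(** [N] is the outermost summation index. A letter y opens a strictly smaller one, and the empty
    word is supported at 0, so all indices of a word ending in y are positive. *)
Fixpoint evw (s : seq bool) (N : nat) : R :=
  match s with
  | [::] => (N == 0)%:R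
  | true :: s' => alpha N * evw s' N
  | false :: s' => beta N * \sum_(M < N) evw s' M
  end.

Definition ev (N : nat) : W -> R := wext f (evw^~ N).
Definition Ev (N : nat) (u : W) : R := \sum_(M < N) ev M u.

Lemma ev_linear N : wlinear f (ev N).
Proof. exact: wext_linear. Qed.

Lemma mulr_morphC (a : K) (b : R) : b * f a = f a * b.
Proof. exact: mulrC. Qed.

Lemma Ev_linear N : wlinear f (Ev N).
Proof.
split=> [u v|c u]; rewrite /Ev.
  by rewrite -big_split; apply: eq_bigr => M _; rewrite (wlinearD (ev_linear M)).
by rewrite mulr_sumr; apply: eq_bigr => M _; rewrite (wlinearZ (ev_linear M)).
Qed.

Lemma ev_word N s : ev N (word W s) = evw s N.
Proof. exact: wext_word. Qed.

Lemma ev1 N : ev N 1 = (N == 0)%:R.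
Proof. by rewrite -(word0 W) ev_word. Qed.

Lemma Ev1 N : Ev N 1 = (0 < N)%:R.
Proof.
rewrite /Ev; case: N => [|N]; first by rewrite big_ord0.
by rewrite big_ord_recl ev1 big1 ?addr0 // => M _; rewrite ev1.
Qed.

Lemma ev_x N u : ev N (x * u) = alpha N * ev N u.
Proof.
move: u; apply: (eq_wlinear (wlinear_mull _ (ev_linear N))).
  exact: (wlinear_scale _ mulr_morphC (ev_linear N)).
by move=> s; rewrite -word_cons !ev_word.
Qed.

Lemma ev_y N u : ev N (y * u) = beta N * Ev N u.
Proof.
move: u; apply: (eq_wlinear (wlinear_mull _ (ev_linear N))).
  exact: (wlinear_scale _ mulr_morphC (Ev_linear N)).
move=> s; rewrite -word_cons ev_word; congr (_ * _).
by apply: eq_bigr => M _; rewrite ev_word.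
Qed.

Definition zpow (k N : nat) : R := alpha N ^+ k.-1 * beta N.

Lemma ev_xX N k u : ev N (x ^+ k * u) = alpha N ^+ k * ev N u.
Proof.
by elim: k => [|k IH]; rewrite ?expr0 ?mul1r // !exprS -!mulrA ev_x IH.
Qed.

Lemma ev_z k N u : ev N (wz W k * u) = zpow k N * Ev N u.
Proof. by rewrite /wz -mulrA ev_xX ev_y /zpow mulrA. Qed.

Lemma Ev_z k N u : Ev N (wz W k * u) = \sum_(M < N) zpow k M * Ev M u.
Proof. by apply: eq_bigr => M _; rewrite ev_z. Qed.

Lemma ev0_Hy u : alpha 0 = 0 -> beta 0 = 0 -> isHy u -> ev 0 u = 0.
Proof.
move=> a0 b0; apply: (eq_wlinear_Hy (L2 := fun=> 0) (ev_linear 0)).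
  by split=> *; rewrite ?addr0 ?mulr0.
by case=> [|[] s]; rewrite ?rcons_cons ev_word /= ?a0 ?b0 mul0r.
Qed.

(** The double sum is split according to which index is larger, or whether they coincide: the three
    terms of the quasi-shuffle recursion. *)
Lemma mul_psums N (a b : nat -> R) :
  (\sum_(M < N) a M) * (\sum_(M < N) b M) =
  \sum_(M < N) (a M * (\sum_(L < M) b L) + b M * (\sum_(L < M) a L) + a M * b M).
Proof.
elim: N => [|N IH]; first by rewrite !big_ord0 mulr0.
by rewrite !big_ord_recr /= -IH; ring.
Qed.

Lemma Ev_qsh c :
  (forall i j N u, (0 < i)%N -> (0 < j)%N ->
     ev N (c i j * u) = zpow i N * zpow j N * Ev N u) ->
  forall us vs N, all (leq 1) us -> all (leq 1) vs ->
  Ev N (qsh c us vs) = Ev N (wwz W us) * Ev N (wwz W vs).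
Proof.
move=> ev_c; apply: qsh_ind => [vs|us|i us j vs H1 H2 H3] N.
- move=> _ _; rewrite wwz_nil Ev1; case: N => [|N]; last by rewrite mul1r.
  by rewrite mul0r /Ev big_ord0.
- move=> _ _; rewrite qsh_nilr wwz_nil Ev1; case: N => [|N]; last by rewrite mulr1.
  by rewrite mulr0 /Ev big_ord0.
move=> /andP[i0 us0] /andP[j0 vs0]; rewrite !wwz_cons !Ev_z.
rewrite [RHS](mul_psums N (fun M => zpow i M * Ev M (wwz W us)) (fun M => zpow j M * Ev M (wwz W vs))).
apply: eq_bigr => M _.
rewrite qsh_cons !(wlinearD (ev_linear M)) !ev_z ev_c // H1 ?H2 ?H3 /= ?i0 ?j0 //.
by rewrite !wwz_cons !Ev_z; ring.
Qed.

Section Oast.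
Variables (c : nat -> nat -> W) (gamma : nat -> R).
Hypothesis alphaE : forall N, alpha N = gamma N * beta N.
Hypothesis ev_c : forall i j N u, (0 < i)%N -> (0 < j)%N ->
  ev N (c i j * u) = zpow i N * zpow j N * Ev N u.

Definition oastw (s s' : seq bool) : W :=
  match decomp s, decomp s' with
  | (i :: u, 0%N), (j :: v, 0%N) => wz W (i + j) * qsh c u v
  | _, _ => 0
  end.

Lemma zpowD i j N : (0 < i)%N -> (0 < j)%N ->
  zpow (i + j) N = gamma N * zpow i N * zpow j N.
Proof.
by case: i j => [//|i] [//|j] _ _; rewrite /zpow addnS /= alphaE exprD exprS; ring.
Qed.

(** The leading letters share the index N, where z_(i+j) has value gamma z_i z_j because alpha =
    gamma beta; the tails multiply by [Ev_qsh]. *)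
Lemma ev_oast N u v : isHy u -> isHy v ->
  ev N (bilext oastw u v) = gamma N * ev N u * ev N v.
Proof.
move=> Hu Hv; move: u Hu.
apply: eq_wlinear_Hy; first exact: (wlinear_endo (ev_linear N) (bilext_linearl _ _)).
  apply: (wlinear_ext (wlinear_scale (ev N v * gamma N) mulr_morphC (ev_linear N))) => u.
  by ring.
move=> s; move: v Hv.
apply: eq_wlinear_Hy; first exact: (wlinear_endo (ev_linear N) (bilext_linearr _ _)).
  exact: (wlinear_scale _ mulr_morphC (ev_linear N)).
move=> s'; rewrite bilext_word /oastw.
case: (decomp_rconsP W s) => i us i0 us0 ->; case: (decomp_rconsP W s') => j vs j0 vs0 ->.
rewrite !wwz_cons !ev_z zpowD // Ev_qsh //; ring.
Qed.

End Oast.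

Section Harmonic.
Variable c : nat -> nat -> W.
Hypothesis ev_c : forall i j N u, (0 < i)%N -> (0 < j)%N ->
  ev N (c i j * u) = zpow i N * zpow j N * Ev N u.

Definition qshw (s s' : seq bool) : W :=
  match decomp s, decomp s' with
  | (u, 0%N), (v, 0%N) => qsh c u v
  | _, _ => 0
  end.

Lemma Ev_qshw N u v : isHy u -> isHy v ->
  Ev N (bilext qshw u v) = Ev N u * Ev N v.
Proof.
move=> Hu Hv; move: u Hu.
apply: eq_wlinear_Hy; first exact: (wlinear_endo (Ev_linear N) (bilext_linearl _ _)).
  apply: (wlinear_ext (wlinear_scale (Ev N v) mulr_morphC (Ev_linear N))) => u.
  exact: mulrC.
move=> s; move: v Hv.
apply: eq_wlinear_Hy; first exact: (wlinear_endo (Ev_linear N) (bilext_linearr _ _)).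
  exact: (wlinear_scale _ mulr_morphC (Ev_linear N)).
move=> s'; rewrite bilext_word /qshw.
case: (decomp_rconsP W s) => i us i0 us0 ->; case: (decomp_rconsP W s') => j vs j0 vs0 ->.
by rewrite Ev_qsh //= ?i0 ?j0.
Qed.

End Harmonic.

End IteratedSums.

(** * The relations at t = 0 for truncated sums, modulo powers of q *)

Section Kawashima.
Variables (K : comNzRingType) (W : wordAlg K) (h : K) (R : comNzRingType).
Variables (f : {rmorphism K -> R}) (q : R) (iv : nat -> R).
Local Notation x := (wx W).
Local Notation y := (wy W).
Hypothesis q_reg : forall a b, q * a = q * b -> a = b.
Hypothesis iv0 : iv 0 = 0.
Hypothesis ivK : forall n, iv n.+1 * qint q n.+1 = 1.
Hypothesis fh : f h = 1 - q.

Definition qiv (N : nat) : R := q ^+ N * iv N.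
(** With x as q^N/[N] and y as 1/[N], z_k takes the value q^((k-1)N)/[N]^k of the q-zeta summand. In
    [sv] both letters are q^N/[N], so z_k becomes (q^N/[N])^k. *)
Definition zv := @ev K W R f qiv iv.
Definition Zv := @Ev K W R f qiv iv.
Definition sv := @ev K W R f qiv qiv.
Definition Sv := @Ev K W R f qiv qiv.

Lemma zv_linear N : wlinear f (zv N).
Proof. exact: ev_linear. Qed.

Definition wphi : W -> W := subst (fun b => if b then x + y else - y).

Lemma wphi_Hy u : isHy u -> isHy (wphi u).
Proof.
case=> P ->; rewrite [wphi _]substM subst_letter.
by apply/isHyM/isHyN; exists 1; rewrite mul1r.
Qed.

Lemma wphi_x u : wphi (x * u) = x * wphi u + y * wphi u.
Proof. by rewrite [LHS]substM subst_letter mulrDl. Qed.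

Lemma wphi_y u : wphi (y * u) = - (y * wphi u).
Proof. by rewrite [LHS]substM subst_letter mulNr. Qed.

(** For N > 0 this is q^N/[N] + (1 - q) = 1/[N]; the extra factor [iv N] covers N = 0. It is why the
    contraction z_(i+j) + h z_(i+j-1) evaluates multiplicatively. *)
Lemma qiv_h N : iv N * (qiv N + f h) = iv N * iv N.
Proof.
rewrite fh /qiv; case: N => [|N]; first by rewrite iv0 !mul0r.
have qE k : (1 - q) * qint q k = 1 - q ^+ k.
  elim: k => [|k IH]; first by rewrite qint0 expr0 mulr0 subrr.
  by rewrite qintSr mulrDr IH exprS; ring.
congr (_ * _); apply: (@qint_reg _ q iv ivK N).
rewrite mulrDr [_ * (1 - q)]mulrC qE.
by rewrite mulrCA [_ * iv _]mulrC ivK mulr1 addrC subrK.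
Qed.

Lemma zv_circ i j N u : (0 < i)%N -> (0 < j)%N ->
  zv N (wcirc_zz W h i j * u) = zpow qiv iv i N * zpow qiv iv j N * Zv N u.
Proof.
case: i j => [//|i] [//|j] _ _; rewrite /wcirc_zz mulrDl -mulrA.
rewrite (wlinearD (zv_linear N)) (wlinearZ (zv_linear N)) /zv !ev_z.
rewrite -/Zv mulrA -mulrDl; congr (_ * _).
rewrite /zpow addSn addnS /= exprS.
transitivity (qiv N ^+ (i + j) * (iv N * (qiv N + f h))); first by ring.
by rewrite qiv_h exprD; ring.
Qed.

Lemma sv_harm i j N u : (0 < i)%N -> (0 < j)%N ->
  sv N (wz W (i + j) * u) = zpow qiv qiv i N * zpow qiv qiv j N * Sv N u.
Proof.
case: i j => [//|i] [//|j] _ _; rewrite /sv ev_z -/Sv; congr (_ * _).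
by rewrite /zpow addSn addnS /= !exprS exprD; ring.
Qed.

Definition woast := bilext (oastw (wcirc_zz W h)).
Definition wharm := bilext (qshw (fun i j => wz W (i + j))).

(** The leading letter z_(i+j) has i + j >= 2, hence starts with x. This places the product in the
    domain of the zeta map. *)
Lemma woast_xHy u v : isHy u -> isHy v -> exists P, woast u v = x * P * y.
Proof.
pose xHy (u : W) := exists P, u = x * P * y.
have xHyD a b : xHy a -> xHy b -> xHy (a + b).
  by move=> [P ->] [Q ->]; exists (P + Q); rewrite mulrDr mulrDl.
have xHyZ c a : xHy a -> xHy (cst W c * a).
  by move=> [P ->]; exists (cst W c * P); rewrite !mulrA cstC.
have xHy0 : xHy 0 by exists 0; rewrite mulr0 mul0r.
rewrite -/(xHy _) => + Hv; elim/isHy_ind: u / => [|u1 u2 IH1 IH2|c s].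
- by rewrite /woast (wlinear0 (bilext_linearl _ v)).
- by rewrite /woast (wlinearD (bilext_linearl _ v)); apply: xHyD.
rewrite /woast (wlinearZ (bilext_linearl _ v)); apply: (xHyZ).
have lin := bilext_linearr (oastw (wcirc_zz W h)) (word W (rcons s false)).
elim/isHy_ind: v / Hv => [|v1 v2 IH1 IH2|d s'].
- by rewrite (wlinear0 lin).
- by rewrite (wlinearD lin); apply: xHyD.
rewrite (wlinearZ lin); apply: xHyZ; rewrite bilext_word /oastw.
case: (decomp_rconsP W s) => i us i0 us0 _; case: (decomp_rconsP W s') => j vs j0 vs0 _.
case: i i0 => // i _; rewrite addSn wzS ?addn_gt0 ?j0 ?orbT // -mulrA.
suff [P ->] : isHy (wz W (i + j) * qsh (wcirc_zz W h) us vs) by exists P; rewrite mulrA.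
apply: isHy_wzM; apply: qsh_near_Hy => a b w Hw; rewrite mulrDl -mulrA.
by apply: isHyD; [apply: isHy_wzM | apply/isHyM/isHy_wzM].
Qed.

Lemma wharm_Hy u v : isHy u -> isHy v -> isHy (wharm u v).
Proof.
apply: bilext_isHy => s s'; rewrite /qshw.
case: (decomp_rconsP W s) => i us _ _ _; case: (decomp_rconsP W s') => j vs _ _ _.
by apply: qsh_Hy => a b w Hw; apply: isHy_wzM.
Qed.

Lemma qtransN B n (a : nat -> R) : qtrans q iv B n (fun N => - a N) = - qtrans q iv B n a.
Proof. by rewrite /qtrans -sumrN; apply: eq_bigr => N _; rewrite mulrN. Qed.

Lemma eq_qtrans B n (a b : nat -> R) : a =1 b -> qtrans q iv B n a = qtrans q iv B n b.
Proof. by move=> ab; apply: eq_bigr => N _; rewrite ab. Qed.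

Lemma qiv0 : qiv 0 = 0.
Proof. by rewrite /qiv iv0 mulr0. Qed.

Lemma Sv_S n u : Sv n.+2 u = Sv n.+1 u + sv n.+1 u.
Proof. by rewrite /Sv /Ev big_ord_recr. Qed.

(** Induction on n: both sides vanish at 0 and have equal increments, the sign in phi(y) = -y
    cancelling that of [qtrans_y]. *)
Lemma qtrans_wphi_y B u :
  (forall n, (n < B.+1)%N -> qtrans q iv B.+1 n (fun N => zv N (wphi u)) = Sv n.+1 u) ->
  forall n, (n < B.+1)%N ->
  qtrans q iv B.+1 n (fun N => zv N (wphi (y * u))) = Sv n.+1 (y * u).
Proof.
move=> IHu n ltn.
have E k : qtrans q iv B.+1 k (fun N => zv N (wphi (y * u))) =
    - qtrans q iv B.+1 k (fun N => iv N * \sum_(M < N) zv M (wphi u)).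
  rewrite -qtransN; apply: eq_qtrans => N.
  by rewrite wphi_y (wlinearN (zv_linear N)) /zv ev_y.
elim: n ltn => [|n IHn] ltn.
  rewrite E qtrans0 // iv0 mul0r oppr0 /Sv /Ev big_ord1.
  by rewrite ev_y qiv0 mul0r.
rewrite Sv_S -(IHn (ltnW ltn)) addrC; apply/eqP; rewrite -subr_eq; apply/eqP.
rewrite !E -opprD (qtrans_y ivK (fun M => zv M (wphi u))) // opprK IHu ?(ltnW ltn) //.
by rewrite /sv ev_y.
Qed.

Lemma qtrans_wphi_x B u : isHy u ->
  (forall n, (n < B.+1)%N -> qtrans q iv B.+1 n (fun N => zv N (wphi u)) = Sv n.+1 u) ->
  forall n, (n < B.+1)%N ->
  qtrans q iv B.+1 n (fun N => zv N (wphi (x * u))) = Sv n.+1 (x * u).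
Proof.
move=> Hu IHu n ltn.
have z0 : zv 0 (wphi u) = 0 by apply: ev0_Hy qiv0 iv0 (wphi_Hy Hu).
have E k : qtrans q iv B.+1 k (fun N => zv N (wphi (x * u))) =
    qtrans q iv B.+1 k (fun N => q ^+ N * iv N * zv N (wphi u) +
                             iv N * \sum_(M < N) zv M (wphi u)).
  apply: eq_qtrans => N.
  by rewrite wphi_x (wlinearD (zv_linear N)) /zv ev_x ev_y.
elim: n ltn => [|n IHn] ltn.
  rewrite E qtrans0 // iv0 mulr0 !mul0r addr0 /Sv /Ev big_ord1.
  by rewrite ev_x qiv0 mul0r.
rewrite Sv_S -(IHn (ltnW ltn)) addrC; apply/eqP; rewrite -subr_eq; apply/eqP.
rewrite !E (qtrans_x ivK (a := fun M => zv M (wphi u))) // !IHu ?(ltnW ltn) // Sv_S addrAC subrr add0r.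
by rewrite /sv ev_x.
Qed.

(* The q-binomial transform intertwines the automorphism phi with the passage from
   the sums of type zeta_q to the harmonic sums in the letters q^m/[m]. *)
Lemma qtrans_wphi B n u : isHy u -> (n < B)%N ->
  qtrans q iv B n (fun N => zv N (wphi u)) = Sv n.+1 u.
Proof.
case: B => // B Hu ltn; move: u Hu.
apply: (@eq_wlinear_Hy _ _ _ f); last 1 first.
- move=> s; elim: s n ltn => [|b s IH] n ltn.
    (* The word y is treated as y times 1: for the element 1, outside H y, both sides are equal to
       1. *)
    rewrite word_rcons word0 mul1r -[y]mulr1; apply: qtrans_wphi_y ltn => {}n ltn.
    rewrite [wphi 1]subst1 /qtrans big_ord_recl /zv ev1 /= expr0 nvaln0 // !mul1r.
    rewrite big1 ?addr0 => [|N _]; last by rewrite ev1 mulr0.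
    by rewrite /Sv Ev1.
  rewrite rcons_cons word_cons; case: b.
    by apply: qtrans_wphi_x ltn => //; apply: isHy_word.
  exact: qtrans_wphi_y ltn.
- have lin N : wlinear f (fun u => zv N (wphi u)).
    exact: wlinear_endo (zv_linear N) (subst_linear _).
  split=> [u v|c u]; rewrite /qtrans.
    rewrite -big_split; apply: eq_bigr => N _.
    by rewrite (wlinearD (lin N)) mulrDr.
  rewrite mulr_sumr; apply: eq_bigr => N _.
  by rewrite (wlinearZ (lin N)) mulrCA.
- exact: Ev_linear.
Qed.

Definition zsumB (B : nat) (u : W) : R := \sum_(N < B) zv N u.

(** This turns the coefficients of the interpolation series into truncated zeta sums of products
    with y^m. *)
Lemma ecoef_zv m N : ecoef iv m N = zv N (y ^+ m).
Proof.
elim: m N => [|m IH] N; first by rewrite expr0 /zv ev1.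
by rewrite exprS /zv ev_y /=; congr (_ * _); apply: eq_bigr => M _; rewrite IH.
Qed.

Lemma kawashima B m u v : (0 < m)%N -> isHy u -> isHy v ->
  qdvd q B (\sum_(1 <= i < m) zsumB B (woast (wphi u) (y ^+ i)) *
                               zsumB B (woast (wphi v) (y ^+ (m - i)))
            - zsumB B (woast (wphi (wharm u v)) (y ^+ m))).
Proof.
move=> m0 Hu Hv; have Huv := wharm_Hy Hu Hv.
pose a w N := zv N (wphi w).
have a0 w : isHy w -> a w 0%N = 0.
  by move=> Hw; apply: ev0_Hy qiv0 iv0 (wphi_Hy Hw).
have yX_Hy i : (0 < i)%N -> isHy (y ^+ i).
  by case: i => // i _; exists (y ^+ i); rewrite exprSr.
have zsumBE w i : isHy w -> (0 < i)%N ->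
    zsumB B (woast (wphi w) (y ^+ i)) = kseries q iv B (a w) i.
  move=> Hw i0; apply: eq_bigr => N _; rewrite ecoef_zv.
  rewrite /zv /woast (@ev_oast _ _ _ _ _ _ _ (fun N => q ^+ N)) //.
  - exact: zv_circ.
  - exact: wphi_Hy.
  - exact: yX_Hy.
(* The constant coefficient sees only N = 0, where [a w] vanishes. Hence the two end terms of the
   Cauchy product drop out. *)
have kseries0 w : isHy w -> kseries q iv B (a w) 0 = 0.
  move=> Hw; apply: big1 => -[[|N] ltN] _ /=; last by rewrite mulr0.
  by rewrite a0 // mulr0 mul0r.
have := @kseries_mul _ q iv q_reg ivK B (a u) (a v) (a (wharm u v)) _ m.
rewrite -[\sum_(i < m.+1) _](big_mkord xpredT
  (fun i => kseries q iv B (a u) i * kseries q iv B (a v) (m - i))).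
rewrite big_nat_recr //= subnn kseries0 // mulr0 addr0.
rewrite big_ltn // kseries0 // mul0r add0r zsumBE //.
have -> : \sum_(1 <= i < m) zsumB B (woast (wphi u) (y ^+ i)) *
                            zsumB B (woast (wphi v) (y ^+ (m - i))) =
    \sum_(1 <= i < m) kseries q iv B (a u) i * kseries q iv B (a v) (m - i).
  by apply: eq_big_nat => i /andP[i0 im]; rewrite !zsumBE // subn_gt0.
(* At X = -[n] the transforms are strict nested sums, which multiply by the harmonic product. *)
apply=> n ltn; rewrite !qtrans_wphi //.
by rewrite -(Ev_qshw sv_harm).
Qed.

End Kawashima.

(** * The ring of power series in q *)

Definition series : Type := PS.

Section SeriesRing.
Implicit Types f g k : PS.

Definition trunc n f : {poly {poly rat}} := \poly_(i < n.+1) f i.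

Lemma coef_trunc n f i : (i <= n)%N -> (trunc n f)`_i = f i.
Proof. by move=> le_in; rewrite coef_poly ltnS le_in. Qed.

(** Low coefficients of a product depend only on truncations, so the ring laws for series are
    inherited from polynomials. *)
Lemma ps_mulE n f g i : (i <= n)%N -> ps_mul f g i = (trunc n f * trunc n g)`_i.
Proof.
move=> le_in; rewrite coefM; apply: eq_bigr => -[j ltj] _ /=.
by rewrite !coef_trunc // (leq_trans _ le_in) ?leq_subr.
Qed.

Lemma ps_mulC : commutative ps_mul.
Proof. by move=> f g; apply/funext => n; rewrite !(ps_mulE _ _ (leqnn n)) mulrC. Qed.

Lemma ps_mulA : associative ps_mul.
Proof.
move=> f g k; apply/funext => n.
transitivity (trunc n f * (trunc n g * trunc n k))`_n.
  rewrite coefM; apply: eq_bigr => -[j ltj] _ /=.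
  by rewrite coef_trunc // -ps_mulE ?leq_subr.
rewrite mulrA coefM; apply: eq_bigr => -[j ltj] _ /=.
by rewrite -ps_mulE // coef_trunc ?leq_subr.
Qed.

Lemma ps_mul1 : left_id ps_one ps_mul.
Proof.
move=> f; apply/funext => n; rewrite /ps_mul big_ord_recl /= /ps_one subn0 mul1r.
by rewrite big1 ?addr0 // => i _; rewrite mul0r.
Qed.

Lemma ps_mulDl : left_distributive ps_mul ps_add.
Proof.
move=> f g k; apply/funext => n; rewrite /ps_mul /ps_add -big_split.
by apply: eq_bigr => i _; rewrite mulrDl.
Qed.

Lemma ps_addA : associative ps_add.
Proof. by move=> f g k; apply/funext => n; rewrite /ps_add addrA. Qed.

Lemma ps_addC : commutative ps_add.
Proof. by move=> f g; apply/funext => n; rewrite /ps_add addrC. Qed.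

Lemma ps_add0 : left_id ((fun _ => 0) : PS) ps_add.
Proof. by move=> f; apply/funext => n; rewrite /ps_add add0r. Qed.

Lemma ps_addN : left_inverse ((fun _ => 0) : PS) ps_opp ps_add.
Proof. by move=> f; apply/funext => n; rewrite /ps_add /ps_opp addNr. Qed.

End SeriesRing.

HB.instance Definition _ := gen_eqMixin series.
HB.instance Definition _ := gen_choiceMixin series.
HB.instance Definition _ := GRing.isZmodule.Build series ps_addA ps_addC ps_add0 ps_addN.

Lemma series_one_neq0 : (ps_one : series) != 0.
Proof.
apply/eqP => /(congr1 (fun f : PS => f 0%N)) /eqP.
by rewrite /ps_one eqxx oner_eq0.
Qed.

HB.instance Definition _ := GRing.Zmodule_isComNzRing.Build series
  ps_mulA ps_mulC ps_mul1 ps_mulDl series_one_neq0.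

Definition coefs (f : series) (n : nat) : {poly rat} := f n.

Lemma coefsM f g n : coefs (f * g) n = \sum_(i < n.+1) coefs f i * coefs g (n - i).
Proof. by []. Qed.

Lemma coefsD f g n : coefs (f + g) n = coefs f n + coefs g n.
Proof. by []. Qed.

Lemma coefsN f n : coefs (- f) n = - coefs f n.
Proof. by []. Qed.

Lemma coefs_sum (I : Type) (r : seq I) (P : pred I) (F : I -> series) n :
  coefs (\sum_(i <- r | P i) F i) n = \sum_(i <- r | P i) coefs (F i) n.
Proof. by elim/big_rec2: _ => // i u v _ <-. Qed.

Lemma seriesP (f g : series) : coefs f =1 coefs g -> f = g.
Proof. by move=> E; apply/funext. Qed.

Definition sq : series := ps_q.

Lemma coefs_sqM f n : coefs (sq * f) n = if n is n'.+1 then coefs f n' else 0.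
Proof.
rewrite coefsM; case: n => [|n]; first by rewrite big_ord1 mul0r.
rewrite big_ord_recl big_ord_recl mul0r add0r mul1r /= subSS subn0.
by rewrite big1 ?addr0 // => i _; rewrite mul0r.
Qed.

Lemma coefs_sqX k f n :
  coefs (sq ^+ k * f) n = if (k <= n)%N then coefs f (n - k) else 0.
Proof.
elim: k n => [|k IH] n; first by rewrite expr0 mul1r subn0.
by rewrite exprS -mulrA coefs_sqM; case: n => [|n] //; rewrite IH ltnS subSS.
Qed.

Lemma sq_reg (a b : series) : sq * a = sq * b -> a = b.
Proof.
move=> ab; apply: seriesP => n.
by have := congr1 (coefs^~ n.+1) ab; rewrite /= !coefs_sqM.
Qed.

Lemma coefs_qdvd B (f : series) n : qdvd sq B f -> (n < B)%N -> coefs f n = 0.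
Proof. by case=> r ->; rewrite coefs_sqX ltnNge; case: leqP. Qed.

Lemma ps_powE (f : series) k : ps_pow f k = f ^+ k.
Proof. by elim: k => // k IH; rewrite exprS -IH. Qed.

Lemma ps_omqE : (ps_omq : series) = 1 - sq.
Proof. by []. Qed.

(** The value 0 at N = 0 removes index 0 from all the nested sums. *)
Definition siv (N : nat) : series := if N is N'.+1 then ps_invbr N else 0.

Lemma geomK N : (1 - sq ^+ N.+1) * (ps_geom N.+1 : series) = 1.
Proof.
apply: seriesP => n; rewrite mulrBl mul1r coefsD coefsN coefs_sqX.
rewrite /coefs /ps_geom; case: leqP => [le_nN | lt_Nn].
  rewrite subr0; case: n le_nN => [|n] le_nN; first by rewrite dvdn0.
  by rewrite gtnNdvd.
by rewrite dvdn_subl // subrr; case: n lt_Nn.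
Qed.

Lemma sivK N : siv N.+1 * qint sq N.+1 = 1.
Proof.
have qE k : (1 - sq) * qint sq k = 1 - sq ^+ k.
  elim: k => [|k IH]; first by rewrite qint0 expr0 mulr0 subrr.
  by rewrite qintSr mulrDr IH exprS mulrBl mul1r addrA subrK.
rewrite /siv [ps_invbr _ : series](_ : _ = (1 - sq) * (ps_geom N.+1 : series)) //.
by rewrite mulrAC qE geomK.
Qed.

(** * Interpolated q-zeta values as truncated sums *)

Definition sconst (c : {poly rat}) : series := fun n => if n == 0%N then c else 0.

Lemma coefs_sconstM c f n : coefs (sconst c * f) n = c * coefs f n.
Proof. by rewrite coefsM big_ord_recl subn0 big1 ?addr0 // => i _; rewrite mul0r. Qed.

Lemma sconst_is_zmod_morphism : zmod_morphism sconst.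
Proof. by move=> c d; apply: seriesP => -[|n]; rewrite coefsD coefsN /coefs /= ?subr0. Qed.

Lemma sconst_is_monoid_morphism : monoid_morphism sconst.
Proof.
split=> [|c d]; apply: seriesP => n; first by case: n.
by rewrite coefs_sconstM /coefs /sconst; case: (n == 0%N); rewrite ?mulr0.
Qed.

HB.instance Definition _ :=
  GRing.isZmodMorphism.Build {poly rat} series sconst sconst_is_zmod_morphism.
HB.instance Definition _ :=
  GRing.isMonoidMorphism.Build {poly rat} series sconst sconst_is_monoid_morphism.

Definition fsubR : {rmorphism A -> series} :=
  [the {rmorphism _ -> _} of horner_eval (1 - sq) \o map_poly sconst].

Lemma fsubRE (a : A) : fsubR a = Defs.fsub a.
Proof.
apply: seriesP => n; rewrite /Defs.fsub /fsubR /= /horner_eval.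
rewrite (@horner_coef_wide _ (size a)) ?size_poly // coefs_sum.
apply: eq_bigr => i _; rewrite coef_map coefs_sconstM.
by rewrite -ps_omqE -ps_powE.
Qed.

Lemma fsubR_h : fsubR hbarA = 1 - sq.
Proof. by rewrite /fsubR /= /horner_eval map_polyX hornerX. Qed.

Lemma fsubR_t : fsubR tA = sconst 'X.
Proof. by rewrite /fsubR /= /horner_eval map_polyC hornerC. Qed.

Lemma fillings_cons k k' ks : fillings (k :: k' :: ks) =
  flatten [seq [:: k :: p; (k + head 0%N p)%N :: behead p;
                   (k + head 0%N p).-1 :: behead p] | p <- fillings (k' :: ks)].
Proof. by []. Qed.

(** The bounds make the natural subtractions in the exponents genuine, and a first entry at least
    [k] keeps every filling convergent when k >= 2. *)
Lemma fillingsP (k : nat) (ks p : seq nat) : (0 < k)%N -> all (leq 1) ks -> p \in fillings (k :: ks) ->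
  exists (j : nat) (l : seq nat), [/\ p = j :: l, (k <= j)%N, all (leq 1) l,
    (size l <= size ks)%N & (j + sumn l <= k + sumn ks)%N].
Proof.
elim: ks k p => [|k' ks IH] k p k_gt0.
  by rewrite inE => _ /eqP ->; exists k, [::].
case/andP=> k'_gt0 ks_gt0; rewrite fillings_cons => /flatten_mapP[p' Hp'].
have [j [l [-> le_j l_gt0 le_l le_s]]] := IH _ _ k'_gt0 ks_gt0 Hp'.
have j_gt0 := leq_trans k'_gt0 le_j.
rewrite !inE /= => /or3P[] /eqP ->;
  [exists k, (j :: l) | exists (k + j)%N, l | exists (k + j).-1, l];
  split=> //=; by rewrite ?l_gt0 ?andbT; lia.
Qed.

Section Zeta.
Variables (W : wordAlg A) (circ : nat -> W -> W) (Sidx : seq nat -> W).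
Hypothesis circ_linear : forall i, wlinear (cst W) (circ i).
Hypothesis circ_word : forall i s, circ i (word W s) =
  if decomp s is (j :: ks, 0%N) then wcirc_zz W hbarA i j * wwz W ks else 0.
Hypothesis Sidx_nil : Sidx [::] = 1.
Hypothesis Sidx_cons : forall k ks,
  Sidx (k :: ks) = wz W k * Sidx ks + cst W tA * circ k (Sidx ks).

Local Notation zv := (@zv _ W _ fsubR sq siv).
Local Notation Zv := (@Zv _ W _ fsubR sq siv).
Local Notation zsumB := (@zsumB _ W _ fsubR sq siv).

Definition fweight (ks p : seq nat) : A :=
  tA ^+ (size ks - size p) * hbarA ^+ (sumn ks - sumn p).

(** Each filling of the tail yields three: the comma is left multiplication by z_k, while + and -1+
    are the two terms of t x^(k-1) (x + hbar). *)
Lemma Sidx_fillings k ks : (0 < k)%N -> all (leq 1) ks ->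
  Sidx (k :: ks) = \sum_(p <- fillings (k :: ks)) cst W (fweight (k :: ks) p) * wwz W p.
Proof.
elim: ks k => [|k' ks IH] k k_gt0.
  move=> _; rewrite Sidx_cons Sidx_nil (circ1 circ_word) mulr0 addr0 mulr1.
  by rewrite big_seq1 /fweight !subnn !expr0 mul1r rmorph1 mul1r wwz_cons wwz_nil mulr1.
move=> /[dup] ks_gt0 /andP[k'_gt0 ks'_gt0].
have [_ ->] := Sidx_cons_Hy circ_linear circ_word Sidx_nil Sidx_cons k_gt0 ks_gt0.
rewrite IH // fillings_cons big_flatten big_map !mulr_sumr -big_split.
rewrite !big_seq; apply: eq_bigr => p Hp /=.
have [j [l [-> le_j l_gt0 le_l le_s]]] := fillingsP k'_gt0 ks'_gt0 Hp.
have j_gt0 := leq_trans k'_gt0 le_j.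
rewrite !big_cons big_nil addr0 [head _ _]/= [behead _]/=.
set w0 := cst W (fweight (k' :: ks) (j :: l)).
have -> : fweight (k :: k' :: ks) (k :: j :: l) = fweight (k' :: ks) (j :: l).
  by rewrite /fweight /= subSS subnDl.
have -> : fweight (k :: k' :: ks) ((k + j)%N :: l) = tA * fweight (k' :: ks) (j :: l).
  rewrite /fweight /= mulrA -exprS -subSn //; congr (_ * _ ^+ _).
  by rewrite -addnA subnDl.
have -> : fweight (k :: k' :: ks) ((k + j).-1 :: l) =
    tA * hbarA * fweight (k' :: ks) (j :: l).
  rewrite /fweight /= mulrACA -!exprS -subSn //; congr (_ * _ ^+ _); lia.
rewrite (rmorphM _ tA (fweight _ _)) (rmorphM _ (tA * hbarA)) (rmorphM _ tA hbarA).
rewrite -/w0 !wwz_cons.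
have -> : wz W (k + j) = wx W ^+ k.-1 * wx W * wz W j.
  rewrite -exprSr prednK // /wz mulrA -exprD; congr (_ ^+ _ * _); lia.
have -> : wz W (k + j).-1 = wx W ^+ k.-1 * wz W j.
  rewrite /wz mulrA -exprD; congr (_ ^+ _ * _); lia.
have w0C u v : u * (w0 * v) = w0 * (u * v) by rewrite mulrA cstC mulrA.
rewrite (mulrDr (_ ^+ _)) mulrDl (mulrDr (cst W tA)).
congr (_ + (_ + _)); first by rewrite w0C.
- by rewrite w0C -!mulrA.
- rewrite w0C [_ * cst W hbarA in LHS]cstC !mulrA.
  by rewrite -(mulrA _ _ w0) [cst W hbarA * w0]cstC !mulrA.
Qed.

Lemma siv_zterm k m : zterm k.+1 m.+1 = zpow (qiv sq siv) siv k.+1 m.+1.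
Proof.
transitivity (sq ^+ (k * m.+1) * siv m.+1 ^+ k.+1); first by rewrite -!ps_powE.
by rewrite /zpow /qiv [_.+1.-1]/= [(sq ^+ _ * _) ^+ k]exprMn -exprM mulnC exprSr mulrA.
Qed.

Lemma zsum_Zv p B n : all (leq 1) p -> (0 < B)%N -> zsum p B n = coefs (Zv B (wwz W p)) n.
Proof.
elim: p B n => [|k p IH] B n; first by move=> _ B0; rewrite wwz_nil /Zv Ev1 B0.
case: k => // k /= p_gt0; case: B => // B _.
rewrite wwz_cons /Zv Ev_z -(big_mkord xpredT (fun M =>
  zpow (qiv sq siv) siv k.+1 M * Zv M (wwz W p))).
(* [Zv] sums from index 0 and [zsum] from 1; the term at 0 is zero as [siv 0] is. *)
rewrite [X in coefs X]big_ltn // {1}/zpow mulr0 mul0r add0r coefs_sum.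
apply: eq_big_nat => -[|m] // /andP[_ ltm].
rewrite -siv_zterm coefsM; apply: eq_bigr => i _.
by congr (_ * _); apply: IH.
Qed.

(** For k >= 2 the leading factor contains q^N, so coefficients below the truncation bound do not
    change when the bound grows. *)
Lemma coefs_zv_wz k N n u : (1 < k)%N -> (n < N)%N -> coefs (zv N (wz W k * u)) n = 0.
Proof.
case: k => [|[|k]] // _ ltn; rewrite /zv ev_z /zpow /= exprS /qiv -!mulrA.
by rewrite coefs_sqX leqNgt ltn.
Qed.

Lemma zsumB_stable k B B' n u : (1 < k)%N -> (n < B)%N -> (B <= B')%N ->
  coefs (zsumB B (wz W k * u)) n = coefs (zsumB B' (wz W k * u)) n.
Proof.
move=> k1 ltn leB; rewrite /zsumB -!(big_mkord xpredT (fun N => zv N (wz W k * u))).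
rewrite (big_cat_nat (n := B) (p := B')) //= coefsD [X in _ = _ + X]coefs_sum.
rewrite [X in _ = _ + X]big_nat [X in _ = _ + X]big1 ?addr0 // => N /andP[leBN _].
by apply: coefs_zv_wz => //; apply: leq_trans leBN.
Qed.

Lemma zsumB_linear B : wlinear fsubR (zsumB B).
Proof. exact: Ev_linear. Qed.

Lemma zeta_qt_zsumB k ks B n : (1 < k)%N -> all (leq 1) ks -> (n < B)%N ->
  zeta_qt (k :: ks) n = coefs (zsumB B (Sidx (k :: ks))) n.
Proof.
move=> k1 ks_gt0 ltn; rewrite Sidx_fillings ?(ltnW k1) //.
rewrite (wlinear_sum (zsumB_linear B)) coefs_sum /zeta_qt !big_seq.
apply: eq_bigr => p Hp; rewrite (wlinearZ (zsumB_linear B)).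
have [j [l [-> le_j l_gt0 _ _]]] := fillingsP (ltnW k1) ks_gt0 Hp.
have j1 := leq_trans k1 le_j.
rewrite /fweight rmorphM !rmorphXn fsubR_t fsubR_h -rmorphXn -mulrA coefs_sconstM.
rewrite /ps_scale; congr (_ * _); rewrite -ps_omqE -ps_powE coefsM.
apply: eq_bigr => -[i lti] _; congr (_ * _) => /=.
rewrite /zeta_q zsum_Zv //= ?l_gt0 ?andbT ?(ltnW j1) // wwz_cons.
(* [zeta_q] truncates just above the coefficient being read; stability moves the bound to the common
   [B]. *)
by apply: zsumB_stable => //; apply: leq_ltn_trans ltn; apply: leq_subr.
Qed.

End Zeta.

(** * The quadratic relations *)

Section KawashimaZeta.
Variables (W : wordAlg A) (circ : nat -> W -> W) (Sidx : seq nat -> W).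
Variables (S Sinv : W -> W).
Local Notation x := (wx W).
Local Notation y := (wy W).
Hypothesis circ_linear : forall i, wlinear (cst W) (circ i).
Hypothesis circ_word : forall i s, circ i (word W s) =
  if decomp s is (j :: ks, 0%N) then wcirc_zz W hbarA i j * wwz W ks else 0.
Hypothesis Sidx_nil : Sidx [::] = 1.
Hypothesis Sidx_cons : forall k ks,
  Sidx (k :: ks) = wz W k * Sidx ks + cst W tA * circ k (Sidx ks).
Hypothesis S_linear : wlinear (cst W) S.
Hypothesis S_word : forall s,
  S (word W s) = Sidx (decomp s).1 * x ^+ (decomp s).2.
Hypothesis S_Sinv : forall u, isHy u -> S (Sinv u) = u.
Hypothesis Sinv_S : forall u, isHy u -> Sinv (S u) = u.

Definition Zw : W -> series := wext fsubR (fun s => zetaW (FMonom s) : series).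

Local Notation zsumB := (@zsumB _ W _ fsubR sq siv).
Local Notation oast := (@woast _ W hbarA).
Local Notation wharm := (@wharm _ W).
Local Notation wphi := (@wphi _ W).
Local Notation Pel := (@wPel _ W tA hbarA).

Let S_HyE := S_Hy circ_linear circ_word Sidx_nil Sidx_cons S_linear S_word.

Lemma Zw_zsumB B n P : (n < B)%N ->
  coefs (Zw (x * P * y)) n = coefs (zsumB B (S (x * P * y))) n.
Proof.
have linZ : wlinear fsubR (fun P => Zw (x * P * y)).
  exact: wlinear_mull (wlinear_mulr _ (wext_linear _ _ _)).
have linS : wlinear fsubR (fun P => zsumB B (S (x * P * y))).
  have linS := wlinear_endo (zsumB_linear W B) S_linear.
  exact: wlinear_mull (wlinear_mulr _ linS).
(* The index [n] stays general because a constant maps to a series in q, and multiplying by it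
   involves lower coefficients. *)
elim/word_ind: P n => [|u v IHu IHv|c s] n ltn.
- by rewrite (wlinear0 linZ) (wlinear0 linS).
- by rewrite (wlinearD linZ) (wlinearD linS) !coefsD IHu ?IHv.
rewrite (wlinearZ linZ) (wlinearZ linS) !coefsM; apply: eq_bigr => -[i lti] _ /=.
have ltk : (n - i < B)%N by apply: leq_ltn_trans ltn; apply: leq_subr.
move: (n - i)%N ltk => k ltk; congr (_ * _).
rewrite -mulrA -word_rcons -word_cons /Zw wext_word S_word /zetaW [fmonom_val _]/= [decomp (true :: _)]/=.
case: (decomp_rconsP W s) => j ks' j_gt0 ks_gt0 _ /=.
rewrite ltnS j_gt0 expr0 mulr1.
by rewrite -(zeta_qt_zsumB circ_linear circ_word Sidx_nil Sidx_cons).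
Qed.

(** The automorphism sigma fixes x, so inverting S on x H y stays inside x H y. *)
Lemma Sinv_xHy P : Sinv (x * P * y) = x * sigma_inv tA hbarA P * y.
Proof.
have -> : x * P * y = S (x * sigma_inv tA hbarA P * y).
  rewrite S_HyE [sigma _ _ _]substM; congr (_ * _ * _).
    exact/esym/subst_letter.
  exact/esym/sigmaK.
by rewrite Sinv_S //; eexists.
Qed.

Definition wphi_ht (u : W) : W := - Sinv (wphi (S u)).
Definition woast_t (u v : W) : W := Sinv (oast (S u) (S v)).

(** Z^t after the inverse of S is the truncated sum at t = 0, and S sends the second factor to y^i.
    The sign is that of [wphi_ht]. *)
Lemma Zw_oast_t B n u i : (n < B)%N -> isHy u -> (0 < i)%N ->
  coefs (Zw (woast_t (wphi_ht u) (Pel ^+ i.-1 * y))) n =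
  - coefs (zsumB B (oast (wphi (S u)) (y ^+ i))) n.
Proof.
move=> ltn Hu i_gt0.
have HSu : isHy (S u) := S_isHy circ_linear circ_word Sidx_nil Sidx_cons S_linear S_word Hu.
have HyX : isHy (y ^+ i) by exists (y ^+ i.-1); rewrite -exprSr prednK.
have Hphi := wphi_Hy HSu.
rewrite /woast_t /wphi_ht (wlinearN S_linear) S_Sinv //.
rewrite (S_wPel circ_linear circ_word Sidx_nil Sidx_cons S_linear S_word) prednK //.
rewrite -coefsN -(wlinearN (zsumB_linear W B)).
rewrite -(wlinearN (bilext_linearl _ (y ^+ i))) -/(oast _ _).
have [P ->] := woast_xHy hbarA (isHyN Hphi) HyX.
rewrite Sinv_xHy (Zw_zsumB _ ltn) -Sinv_xHy S_Sinv //.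
by eexists.
Qed.

Lemma kawashima_zeta m v w n : (0 < m)%N -> isHy v -> isHy w ->
  \sum_(1 <= i < m)
    coefs (Zw (woast_t (wphi_ht v) (Pel ^+ i.-1 * y)) *
           Zw (woast_t (wphi_ht w) (Pel ^+ (m - i).-1 * y))) n
  = - coefs (Zw (woast_t (wphi_ht (Sinv (wharm (S v) (S w)))) (Pel ^+ m.-1 * y))) n.
Proof.
move=> m_gt0 Hv Hw.
have SHy u : isHy u -> isHy (S u).
  exact: (S_isHy circ_linear circ_word Sidx_nil Sidx_cons S_linear S_word).
have Hvw := wharm_Hy (SHy _ Hv) (SHy _ Hw).
have HSinv : isHy (Sinv (wharm (S v) (S w))).
  case: Hvw => P ->.
  rewrite -(S_sigma_inv circ_linear circ_word Sidx_nil Sidx_cons S_linear S_word).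
  by rewrite Sinv_S; eexists.
(* Divisibility by q^(n+1) settles the coefficient of q^n, so truncating at n + 1 suffices. *)
have q := kawashima sq_reg (erefl : siv 0 = 0) sivK fsubR_h n.+1 m_gt0 (SHy _ Hv) (SHy _ Hw).
have {q} := coefs_qdvd q (ltnSn n); rewrite coefsD coefsN => /eqP.
rewrite subr_eq0 => /eqP E.
rewrite (Zw_oast_t (ltnSn n)) // S_Sinv // opprK -E coefs_sum.
apply: eq_big_nat => i /andP[i_gt0 lt_im]; rewrite !coefsM.
apply: eq_bigr => -[j ltj] _ /=.
by rewrite !(Zw_oast_t (B := n.+1)) ?subn_gt0 ?ltnS ?leq_subr // mulrNN.
Qed.

End KawashimaZeta.

(** * The concrete algebra H *)

Lemma mulr_comm2 (R : nzRingType) (a b c : R) :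
  a * c = c * a -> b * c = c * b -> a * b * c = c * (a * b).
Proof. by move=> ac bc; rewrite -mulrA bc !mulrA ac. Qed.

Definition cstH : {rmorphism A -> H} := [the {rmorphism A -> H} of (fun c : A => c%:MP)].

Lemma wordH_cat s s' : wordH (s ++ s') = wordH s * wordH s'.
Proof. by rewrite /wordH [RHS]fgmulUU mulr1 [mmul _ _]fmmulE. Qed.

Lemma wordH0 : wordH [::] = 1.
Proof. by rewrite /wordH -fmoneE. Qed.

Lemma cstH_scale c (u : H) : c *: u = cstH c * u.
Proof. by rewrite -[LHS]mul_malgC. Qed.

Lemma cstH_word c (k : Word) : << c *g k >> = cstH c * << k >> :> H.
Proof. by rewrite [RHS]fgmulUU mulr1 mul1m. Qed.

Lemma wordH_ind (P : H -> Prop) :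
  P 0 -> (forall u v, P u -> P v -> P (u + v)) ->
  (forall c s, P (cstH c * wordH s)) -> forall u, P u.
Proof.
move=> P0 PD Pw u; rewrite [u]monalgE; apply: big_ind => // -[s] _.
rewrite cstH_word; exact: Pw.
Qed.

Lemma wordH_cstC s c : wordH s * cstH c = cstH c * wordH s.
Proof. by rewrite -cstH_word [LHS]fgmulUU mul1r mulm1. Qed.

Lemma cstHC c u : u * cstH c = cstH c * u.
Proof.
elim/wordH_ind: u => [|u1 u2 IH1 IH2|d s]; first by rewrite mul0r mulr0.
  by rewrite mulrDl mulrDr IH1 IH2.
have cst_comm : cstH d * cstH c = cstH c * cstH d.
  by rewrite -[LHS]rmorphM -[RHS]rmorphM; congr (cstH _); apply: mulrC.
exact: mulr_comm2 cst_comm (wordH_cstC s c).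
Qed.

Section WordExtension.
Variables (S : nzRingType) (f : {rmorphism A -> S}) (h : seq bool -> S).

Definition extH (u : H) : S := mmap f (fun w : Word => h (fmonom_val w)) u.

Lemma extHD u v : extH (u + v) = extH u + extH v.
Proof. exact: mmapD. Qed.

Lemma extHZ c u : extH (cstH c * u) = f c * extH u.
Proof.
rewrite -cstH_scale /extH (mmapEw (msuppZ_le c u)) mmapE mulr_sumr.
apply: eq_bigr => k _.
by rewrite mcoeffZ mulrA; congr (_ * _); apply: (rmorphM f).
Qed.

Lemma extH_word s : extH (wordH s) = h s.
Proof. by rewrite [LHS]mmapU -[RHS]mul1r; congr (_ * _); apply: (rmorph1 f). Qed.

End WordExtension.

Definition HW : wordAlg A :=
  @WordAlg A H cstH wordH extH cstHC wordH0 wordH_cat wordH_ind extHD extHZ extH_word.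

Lemma circ_zzE : circ_zz = wcirc_zz HW hbarA.
Proof. by apply/funext => i; apply/funext => j; congr (_ + _); apply: cstH_scale. Qed.

Lemma oastE u v : oast u v = @woast A HW hbarA u v.
Proof. by rewrite /woast -circ_zzE. Qed.

Lemma PelE : Pel = wPel HW tA hbarA.
Proof. exact: (congr1 (fun u => - u + yH - (hbarA * tA)%:MP) (cstH_scale tA xH)). Qed.

Lemma S_idx_cons k ks :
  S_idx (k :: ks) = wz HW k * S_idx ks + cst HW tA * circ k (S_idx ks).
Proof. by congr (_ + _); apply: cstH_scale. Qed.

Lemma circ_wordE i s : circ i (word HW s) =
  if decomp s is (j :: ks, 0%N) then wcirc_zz HW hbarA i j * wwz HW ks else 0.
Proof. by rewrite -circ_zzE; exact: (@wext_word A HW _ cstH (fun s' => circ_word i (FMonom s'))). Qed.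

Lemma S_ht_wordE s :
  S_ht (word HW s) = S_idx (decomp s).1 * wx HW ^+ (decomp s).2.
Proof.
transitivity (S_word (FMonom s)); first exact: (@wext_word A HW _ cstH (fun s' => S_word (FMonom s'))).
by rewrite /S_word /=; case: (decomp s).
Qed.

Lemma circ_linearH i : @wlinear A HW HW cstH (circ i).
Proof. exact: (@wext_linear A HW _ cstH (fun s => circ_word i (FMonom s))). Qed.

Lemma S_ht_linearH : @wlinear A HW HW cstH S_ht.
Proof. exact: (@wext_linear A HW _ cstH (fun s => S_word (FMonom s))). Qed.

Lemma ZqtE u : Zqt u = Zw (W := HW) u.
Proof.
apply: seriesP => n; rewrite /Zw /= /extH /mmap coefs_sum.
by apply: eq_bigr => -[k] _; rewrite fsubRE.
Qed.

Lemma inHy_isHy u : inHy u -> isHy (W := HW) u.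
Proof.
move=> Hu; rewrite [u]monalgE big_seq; elim/big_ind: _ => //.
- exact: (@isHy0 A HW).
- exact: (@isHyD A HW).
(* The default [true] of [last] in [inHy] rules out the empty word. *)
move=> -[k] /Hu /=; case/lastP: k => //= s b; rewrite last_rcons => ->.
rewrite cstH_word; exact: (@isHyM A HW _ _ (isHy_word HW _)).
Qed.

Lemma isHy_inH1 u : isHy (W := HW) u -> inH1 u.
Proof.
elim/isHy_ind: u / => [k|u v Hu Hv k|c s k].
- by rewrite msupp0 in_fset0.
- by move/(fsubsetP (msuppD_le _ _)); rewrite in_fsetU => /orP[/Hu|/Hv].
- rewrite -cstH_scale => /(fsubsetP (msuppZ_le _ _)).
  by rewrite msuppU1 in_fset1 => /eqP -> /=; rewrite last_rcons.
Qed.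

Theorem theorem1p2 (Sinv : H -> H)
  (Sinv_H1 : forall u, inH1 u -> inH1 (Sinv u))
  (S_Sinv : forall u, inH1 u -> S_ht (Sinv u) = u)
  (Sinv_S : forall u, inH1 u -> Sinv (S_ht u) = u)
  (m : nat) (v w : H) :
  (1 <= m)%N -> inHy v -> inHy w ->
  (fun n => \sum_(1 <= i < m)
      ps_mul (Zqt (oast_t Sinv (phi_ht Sinv v) (Pel ^+ i.-1 * yH)))
             (Zqt (oast_t Sinv (phi_ht Sinv w) (Pel ^+ (m - i).-1 * yH))) n)
  = ps_opp (Zqt (oast_t Sinv (phi_ht Sinv (Sinv (harmonic (S_ht v) (S_ht w))))
                        (Pel ^+ m.-1 * yH))).
Proof.
move=> m_gt0 /inHy_isHy Hv /inHy_isHy Hw; apply/funext => n.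
have oast_tE u u' : oast_t Sinv u u' = woast_t (W := HW) S_ht Sinv u u'.
  by rewrite /oast_t oastE.
have E := kawashima_zeta (W := HW) circ_linearH circ_wordE erefl S_idx_cons
  S_ht_linearH S_ht_wordE (fun u Hu => S_Sinv u (isHy_inH1 Hu))
  (fun u Hu => Sinv_S u (isHy_inH1 Hu)) n m_gt0 Hv Hw.
rewrite -PelE in E.
pose G u i : series := Zqt (oast_t Sinv (phi_ht Sinv u) (Pel ^+ i * yH)).
pose F u i : series :=
  Zw (W := HW) (woast_t (W := HW) S_ht Sinv (wphi_ht (W := HW) S_ht Sinv u) (Pel ^+ i * wy HW)).
have GF : G = F.
  by apply/funext => u; apply/funext => i; rewrite /G oast_tE ZqtE.
(* The operations on [PS] are by definition those of the ring [series], and [harmonic] is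
   convertible with the abstract product [wharm] over [HW]. *)
change (\sum_(1 <= i < m) coefs (G v i.-1 * G w (m - i).-1) n =
        - coefs (G (Sinv (harmonic (S_ht v) (S_ht w))) m.-1) n).
by rewrite GF; exact: E.
Qed.
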